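(* For every betting sequence on the filtered space described in the context, every $s\in[0,\infty)$ and every $t\in\mathbb N$, $$\Lambda^{(t)}_s\ \le\ \frac1t\sum_{n\le t}\bar\lambda_n(0^+),\qquad \bar\lambda_n(0^+):=\operatorname*{ess\,sup}_{\mathbb P_1}\lambda_n(0^+),$$ and the same bound therefore holds for $\Lambda^{(t)}=\sup_{s\ge0}\Lambda^{(t)}_s$. Moreover $$\lambda_n(0^+)\ =\ -\mathbb E_{\mathbb P_0}\big[\log R_n\mid\mathcal F_{n-1}\big]\qquad\text{a.s.}$$ In the i.i.d. model the right-hand side of the first bound is $\lim_{\beta\downarrow0}\lambda(\beta)=\mathrm{KL}(P_0\|P_1)$, so $$\Lambda^{(t)}_s\le\mathrm{KL}(P_0\|P_1),$$ and in particular $\Lambda(E)\le\mathrm{KL}(P_0\|P_1)$ for every measurable $E:\mathcal X\to[0,\infty]$ with $\mathbb E_{P_0}[E]\le1$.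
   Context: Setting: $(\Omega,\mathcal F)$ is a measurable space with a filtration $(\mathcal F_t)_{t\in\mathbb N_0}$, $\mathcal F_0=\{\emptyset,\Omega\}$, and $\mathbb P_0,\mathbb P_1$ are probability measures on it. Standing assumption: for every $t\in\mathbb N=\{1,2,\dots\}$, $\mathbb P_1\ll\mathbb P_0$ on $\mathcal F_t$ and $\mathrm{KL}(\mathbb P_1|_{\mathcal F_t}\|\mathbb P_0|_{\mathcal F_t})<\infty$. ($\mathrm{KL}(Q\|P)=\mathbb E_Q[\log\frac{dQ}{dP}]$ if $Q\ll P$, and $+\infty$ otherwise.) $L_t:=\frac{d\mathbb P_1|_{\mathcal F_t}}{d\mathbb P_0|_{\mathcal F_t}}$, $L_0=1$; $R_t:=L_t/L_{t-1}$ on $\{L_{t-1}>0\}$, $R_t:=1$ elsewhere. For $\beta\in(0,1]$: $Z_{\beta,t}:=\mathbb E_{\mathbb P_0}[R_t^\beta\mid\mathcal F_{t-1}]$, $\lambda_t(\beta):=-\frac1\beta\log Z_{\beta,t}$, which is a.s. nonnegative and nonincreasing in (rational) $\beta$; $\lambda_t(0^+):=\lim_{\beta\downarrow0}\lambda_t(\beta)=\sup_{\beta\in(0,1]\cap\mathbb Q}\lambda_t(\beta)\in[0,\infty]$. The a.s. identity for $\lambda_n(0^+)$ is meant $\mathbb P_0$-a.s. (hence $\mathbb P_1$-a.s.). A betting sequence is a sequence $(E_t)_{t\in\mathbb N}$ of $\mathcal F_t$-measurable $E_t:\Omega\to[0,\infty]$ with $\mathbb E_{\mathbb P_0}[E_t\mid\mathcal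 F_{t-1}]\le1$ $\mathbb P_0$-a.s.; $W_0=1$, $W_t=\prod_{n\le t}E_n$; $\Lambda^{(t)}_s:=-\frac1t\log\mathbb E_{\mathbb P_1}[W_t^{-s}]$. The i.i.d. model generated by probability measures $P_0,P_1$ on $(\mathcal X,\mathcal B_{\mathcal X})$ is the instance $\Omega=\mathcal X^{\mathbb N}$ with coordinates $X_n$, $\mathcal F_t=\sigma(X_1,\dots,X_t)$, $\mathbb P_i=P_i^{\otimes\mathbb N}$; the standing assumption then says $P_1\ll P_0$, $\mathrm{KL}(P_1\|P_0)<\infty$. There $R:=\frac{dP_1}{dP_0}$, $\lambda(\beta):=-\frac1\beta\log\mathbb E_{P_0}[R^\beta]$, and $\Lambda(E):=\sup_{s\ge0}\{-\log\mathbb E_{P_1}[E^{-s}]\}$. Conventions: $x^0=1$; for $s>0$, $0^{-s}=+\infty$, $(+\infty)^{-s}=0$; $0\cdot\infty=0$; $\log0=-\infty$, $\log(+\infty)=+\infty$. *)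

(* Defs.v *)
From HB Require Import structures.
From mathcomp Require Import all_boot all_order all_algebra.
From mathcomp Require Import all_classical all_reals all_analysis.
From mathcomp Require Import measurable_realfun ess_sup_inf.

Set Implicit Arguments.
Unset Strict Implicit.
Unset Printing Implicit Defensive.
Import Order.TTheory GRing.Theory Num.Theory.
Import numFieldNormedType.Exports.
Local Open Scope classical_set_scope.
Local Open Scope ring_scope.
Local Open Scope ereal_scope.

Record filtration d (T : measurableType d) := Filtration {
  sigma_at :> nat -> set (set T) ;
  sigma_at_sigma : forall t, sigma_algebra setT (sigma_at t) ;
  sigma_at_sub : forall t, sigma_at t `<=` measurable ;
  sigma_at_mono : forall s t, (s <= t)%N -> sigma_at s `<=` sigma_at t ;
  sigma_at0 : sigma_at 0%N = [set set0; setT] }.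

(* Measurability with respect to a sub-sigma-algebra G is measurability of
   functions on [g_sigma_algebraType G], the same carrier equipped with <<s G>>,
   which is G itself when G is already a sigma-algebra. *)
Definition measurable_wrt (T : pointedType) (G : set (set T)) (R : realType)
    (f : T -> \bar R) :=
  measurable_fun [set: g_sigma_algebraType G]
    (f : g_sigma_algebraType G -> \bar R).

Section restriction.
Context d (T : measurableType d) (F : filtration T) (t : nat).

Definition to_stage : T -> g_sigma_algebraType (F t) := id.

Let measurable_to_stage : measurable_fun [set: T] to_stage.
Proof.
move=> _ A FA; rewrite setTI.
have : <<s F t >> A by [].
by rewrite (sigma_algebra_id (sigma_at_sigma F t)); exact: sigma_at_sub.
Qed.

HB.instance Definition _ := isMeasurableFun.Build _ _ _ _ to_stage
  measurable_to_stage.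

(* P|_{F_t}: the image of P under the identity (T, d) -> (T, F_t) *)
Definition restr (R : realType) (P : probability T R) :
  probability (g_sigma_algebraType (F t)) R := distribution P to_stage.

End restriction.

Section information.
Context d (T : measurableType d) (R : realType).
Implicit Types P Q : probability T R.

Definition density Q P : T -> \bar R := Radon_Nikodym (charge_of_finite_measure Q) P.

Definition KL Q P : \bar R :=
  if `[< Q `<< P >] then \int[Q]_w lne (density Q P w) else +oo.

(* g is a version of E_P[f | G].  The function f may take infinite values and
   need not be integrable; it is only required that one of E_P[f^+], E_P[f^-]
   be finite, so that E_P[f | G] = E_P[f^+ | G] - E_P[f^- | G] makes sense and is
   characterized up to P-null sets by its integrals over the sets of G.
   For every measurable f of this kind and every sub-sigma-algebra G such a g
   exists (Radon-Nikodym and monotone limits), so that the default value in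
   [condexp] is not used for them. *)
Definition is_condexp P (G : set (set T)) (f g : T -> \bar R) :=
  [/\ measurable_fun [set: T] f,
      \int[P]_w f^\+ w < +oo \/ \int[P]_w f^\- w < +oo,
      measurable_wrt G g &
      forall A, G A -> \int[P]_(w in A) g w = \int[P]_(w in A) f w].

Definition condexp P (G : set (set T)) (f : T -> \bar R) : T -> \bar R :=
  xget (cst 0) [set g | is_condexp P G f g].

End information.

Section growth.
Context d (T : measurableType d) (R : realType) (F : filtration T).
Variables P0 P1 : probability T R.

Definition standing_assumption := forall t, (0 < t)%N ->
  restr F t P1 `<< restr F t P0 /\ KL (restr F t P1) (restr F t P0) < +oo.

Definition lik t : T -> \bar R := density (restr F t P1) (restr F t P0).

Definition lik_ratio t (w : T) : \bar R :=
  if 0 < lik t.-1 w then lik t w / lik t.-1 w else 1.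

Definition hellinger (b : R) t : T -> \bar R :=
  condexp P0 (F t.-1) (fun w => lik_ratio t w `^ b).

Definition lam t (b : R) (w : T) : \bar R :=
  - ((b^-1)%:E * lne (hellinger b t w)).

(* Each [lam t b] is only defined up to a null set, so the limit b -> 0+ is taken
   as the supremum over the countably many rational b. *)
Definition lam0 t (w : T) : \bar R :=
  ereal_sup [set lam t (ratr q) w | q in [set q : rat | (0 < q <= 1)%R]].

Definition lam0_mean t : \bar R :=
  (t%:R^-1)%:E * \sum_(1 <= n < t.+1) ess_sup P1 (lam0 n).

Definition betting (E : nat -> T -> \bar R) := forall t, (0 < t)%N ->
  [/\ measurable_wrt (F t) (E t),
      forall w, 0 <= E t w &
      {ae P0, forall w, condexp P0 (F t.-1) (E t) w <= 1}].

Definition wealth (E : nat -> T -> \bar R) t (w : T) : \bar R :=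
  \prod_(1 <= n < t.+1) E n w.

(* [(x `^ s)^-1] in \bar R follows the conventions for x^{-s}: it is 1 for s = 0,
   and for s > 0 it is +oo at x = 0 and 0 at x = +oo. *)
Definition growth (E : nat -> T -> \bar R) (s : R) t : \bar R :=
  - ((t%:R^-1)%:E * lne (\int[P1]_w (wealth E t w `^ s)^-1)).

Definition growth_sup (E : nat -> T -> \bar R) t : \bar R :=
  ereal_sup [set growth E s t | s in [set s | (0 <= s)%R]].

End growth.

Section single_letter.
Context d (X : measurableType d) (R : realType).
Variables P0 P1 : probability X R.

Definition lam_iid (b : R) : \bar R :=
  - ((b^-1)%:E * lne (\int[P0]_x (density P1 P0 x `^ b))).

Definition growth_iid (E : X -> \bar R) : \bar R :=
  ereal_sup [set - lne (\int[P1]_x (E x `^ s)^-1) | s in [set s : R | (0 <= s)%R]].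

End single_letter.

Section iid_model.
Context d (X : measurableType d).

(* X_1, X_2, ... are the coordinates 0, 1, ... of an element of nat -> X. *)
Definition coord_sets (i : nat) : set (set (nat -> X)) :=
  preimage_set_system [set: nat -> X] (fun w => w i) measurable.

Definition seq_space := g_sigma_algebraType (\bigcup_i coord_sets i).

HB.instance Definition _ := Measurable.on seq_space.

Definition coord_sigma (t : nat) : set (set seq_space) :=
  <<s \bigcup_(i in [set i | (i < t)%N]) coord_sets i >>.

Let coord_sigma_sigma t : sigma_algebra setT (coord_sigma t).
Proof. exact: smallest_sigma_algebra. Qed.

Let coord_sigma_sub t : coord_sigma t `<=` measurable.
Proof. by apply: sub_sigma_algebra2 => A [i _ iA]; exists i. Qed.

Let coord_sigma_mono s t : (s <= t)%N -> coord_sigma s `<=` coord_sigma t.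
Proof.
by move=> st; apply: sub_sigma_algebra2 => A [i /= si iA]; exists i => //=;
  exact: leq_trans st.
Qed.

Let coord_sigma0 : coord_sigma 0%N = [set set0; setT].
Proof.
rewrite /coord_sigma (_ : [set i | (i < 0)%N] = set0); last by apply/seteqP; split.
rewrite bigcup_set0; apply/seteqP; split.
  apply: smallest_sub => //; split; first by left.
    by move=> A [->|->]; [right; rewrite setD0|left; rewrite setDv].
  move=> A hA; have [[n An]|hn] := pselect (exists n, A n = setT).
    by right; apply/seteqP; split => // x _; exists n => //; rewrite An.
  left; apply/seteqP; split => // x [n _]; case: (hA n) => [->//|An].
  by exfalso; apply: hn; exists n.
move=> A [->|->]; first exact: sigma_algebra0.
have [s0 sC _] := @smallest_sigma_algebra seq_space setT set0.
by have := sC _ s0; rewrite setD0.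
Qed.

Definition iid_filtration : filtration seq_space :=
  Filtration coord_sigma_sigma coord_sigma_sub coord_sigma_mono coord_sigma0.

(* PP is the infinite product measure of P, which is determined by its values
   on the finite-dimensional rectangles. *)
Definition is_iid_product (R : realType) (P : probability X R)
    (PP : probability seq_space R) :=
  forall n (A : nat -> set X), (forall i, measurable (A i)) ->
    PP [set w | forall i, (i < n)%N -> A i (w i)] = \prod_(i < n) P (A i).

End iid_model.

(* Main.v *)
(** Both halves rest on tangent inequalities for the logarithm.  For [r >= 0]
    and [b] decreasing to [0], [(r^b - 1) / b] decreases to [log r]; integrating
    over sets of [F_(n-1)], monotone convergence gives
    [lambda_n(0+) >= - E_P0[log R_n | F_(n-1)]], and
    [b log r <= r^b exp(- c) - 1 + c] (Jensen's inequality) gives the converse.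
    For the growth bound, with [l] an upper bound of [lambda_n(0+)], integrate
    [r x^(-s) >= exp(- l) (1 + l + log r + s (1 - x))] at [r = R_n], [x = E_n]:
    since [E_P0[E_n | F_(n-1)] <= 1], it follows that
    [E_P1[E_n^(-s) | F_(n-1)] >= exp(- l)], and induction on [t] concludes.
    In the i.i.d. model [L_n] is the product of the [R(X_i)], so that
    [lambda_n(0+) = - E_P0[log R]] almost surely for [PP1], the law of the
    sequence, and [- E_P0[log R] = KL(P0 || P1)] because [dP0/dP1 = 1/R] when
    [P0 << P1], while both sides are infinite otherwise. *)
Require Import Defs.
From HB Require Import structures.
From mathcomp Require Import all_boot all_order all_algebra.
From mathcomp Require Import all_classical all_reals all_analysis.
From mathcomp Require Import measurable_realfun ess_sup_inf.
From mathcomp Require Import ring lra.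

Set Implicit Arguments.
Unset Strict Implicit.
Unset Printing Implicit Defensive.
Import Order.TTheory GRing.Theory Num.Theory.
Import numFieldNormedType.Exports.
Local Open Scope classical_set_scope.
Local Open Scope ring_scope.
Local Open Scope ereal_scope.

(** * Integration *)

(** The functions involved are extended-valued and [log R_n] may have integral [-oo], so almost sure
    inequalities between conditional quantities are not derived pointwise: [f <= g] is reduced to
    [P B = 0] for the sets [B] where [f >= b] and [g <= a], with real [a < b]. On such a set the
    integrals have one-sided bounds by finite multiples of [P B], and Jensen's inequality or
    monotone convergence is applied over [B] alone. Exceptional sets are kept inside [F t], since
    [P1] is absolutely continuous with respect to [P0] only on each stage. Taking a factor known at
    stage [t] out of a conditional expectation is replaced by a comparison principle: an inequality
    of integrals over all preimages of measurable sets passes to nonnegative weights. The same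
    principle gives the change of measure and the independence of coordinates. The inequality behind
    the growth bound is [exp u >= 1 + u] at [u = l + log r - s log x], followed by [log x <= x - 1];
    both are equalities at [r = exp (- l)], [x = 1]. *)

Section integral_lemmas.
Context d (T : measurableType d) (R : realType).
Variable mu : {measure set T -> \bar R}.
Implicit Types (f g : T -> \bar R) (D : set T).

(* No integrability is needed: with the convention +oo - oo = -oo the
   difference of the integrals of the two parts is monotone. *)
Lemma ae_le_integral D f g : measurable D ->
    measurable_fun D f -> measurable_fun D g ->
    {ae mu, forall x, D x -> f x <= g x} ->
  \int[mu]_(x in D) f x <= \int[mu]_(x in D) g x.
Proof.
move=> mD mf mg fg; rewrite [leLHS]integralE [leRHS]integralE; apply: leeB.
- apply: ae_ge0_le_integral => //; try exact: measurable_funepos.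
  apply: filterS fg => x + Dx => /(_ Dx) fgx.
  by rewrite !funeposE ge_max !le_max lexx fgx orbT.
- apply: ae_ge0_le_integral => //; try exact: measurable_funeneg.
  apply: filterS fg => x + Dx => /(_ Dx) fgx.
  by rewrite !funenegE ge_max !le_max lexx leeN2 fgx orbT.
Qed.

Lemma ae_cst_le_integral D f (k : R) : measurable D -> measurable_fun D f ->
    {ae mu, forall x, D x -> k%:E <= f x} ->
  k%:E * mu D <= \int[mu]_(x in D) f x.
Proof.
by move=> mD mf kf; rewrite -(integral_cst mu mD); exact: ae_le_integral.
Qed.

Lemma ae_integral_le_cst D f (k : R) : measurable D -> measurable_fun D f ->
    {ae mu, forall x, D x -> f x <= k%:E} ->
  \int[mu]_(x in D) f x <= k%:E * mu D.
Proof.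
by move=> mD mf fk; rewrite -(integral_cst mu mD); exact: ae_le_integral.
Qed.

(** A negative part of infinite integral would force the integral of [f] to be [-oo], by the
    convention for [+oo - oo]; the positive part is dominated by that of [g]. *)
Lemma integrable_of_le D f g : measurable D -> measurable_fun D f ->
    mu.-integrable D g -> (forall x, D x -> f x <= g x) ->
    -oo < \int[mu]_(x in D) f x ->
  mu.-integrable D f.
Proof.
move=> mD mf ig fg fNy.
have fp : \int[mu]_(x in D) f^\+ x < +oo.
  apply: le_lt_trans (integral_funepos_lt_pinfty mD ig).
  apply: ge0_le_integral => //; first exact: measurable_funepos.
  - by apply: measurable_funepos; apply: measurable_int ig.
  - by move=> x Dx; rewrite !funeposE ge_max !le_max lexx (fg x Dx) orbT.
have fn : \int[mu]_(x in D) f^\- x < +oo.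
  rewrite ltNge leye_eq; apply/negP => /eqP fny.
  by move: fNy; rewrite integralE fny addeNy ltxx.
apply/integrableP; split => //.
under eq_integral do rewrite -/((abse \o f) _) fune_abse.
rewrite ge0_integralD//; [|exact: measurable_funepos|exact: measurable_funeneg].
by rewrite lte_add_pinfty.
Qed.

(** Only [f] is integrable. If [g] has infinite integral, both sides are [-oo]: otherwise [f - g]
    would be integrable, and so would [g], which is at most [|f| + |f - g|]. *)
Lemma integral_ge0B D f g : measurable D -> measurable_fun D g ->
    mu.-integrable D f -> (forall x, D x -> 0 <= f x) ->
    (forall x, D x -> 0 <= g x) ->
  \int[mu]_(x in D) (f x - g x) =
  \int[mu]_(x in D) f x - \int[mu]_(x in D) g x.
Proof.
move=> mD mg int_f f0 g0; have mf := measurable_int mu int_f.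
have [gy|gy] := ltP (\int[mu]_(x in D) g x) +oo.
  rewrite integralB//; apply/integrableP; split => //.
  by under eq_integral => x /[!inE] Dx do rewrite gee0_abs ?g0//.
move: gy; rewrite leye_eq => /eqP gy; rewrite gy addeNy.
apply/eqP; rewrite -leeNy_eq leNgt; apply/negP => fgNy.
have ifg : mu.-integrable D (fun x => f x - g x).
  apply: (@integrable_of_le D _ f) => //; first exact: emeasurable_funB.
  by move=> x Dx; rewrite -[leRHS]sube0 leeB// g0.
suff : \int[mu]_(x in D) g x < +oo by rewrite gy.
apply: (@le_lt_trans _ _ (\int[mu]_(x in D) (`|f x| + `|f x - g x|))).
  apply: ge0_le_integral => //.
    apply: emeasurable_funD; first exact: measurableT_comp.
    by apply: measurableT_comp => //; exact: emeasurable_funB.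
  move=> x Dx; have := f0 _ Dx; have := g0 _ Dx.
  case: (f x) => [a| |]; case: (g x) => [b| |] //= b0 a0; rewrite ?leey//.
  rewrite lee_fin; have := ler_norm a; have := ler_norm (b - a)%R.
  by rewrite distrC; lra.
have [_ fi] := integrableP _ _ _ int_f; have [mfg fgi] := integrableP _ _ _ ifg.
rewrite ge0_integralD//; [|exact: measurableT_comp|exact: measurableT_comp].
by rewrite lte_add_pinfty.
Qed.

Lemma ge0_fin_integrable D f : measurable_fun D f ->
    (forall x, D x -> 0 <= f x) ->
  \int[mu]_(x in D) f x < +oo -> mu.-integrable D f.
Proof.
move=> mf f0 fy; apply/integrableP; split => //.
by under eq_integral => x /[!inE] Dx do rewrite gee0_abs ?f0//.
Qed.

End integral_lemmas.

(** * Comparison of weighted integrals along measurable maps *)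

Section integral_weight.
Context d1 d2 d3 (T1 : measurableType d1) (T2 : measurableType d2)
  (Y : measurableType d3) (R : realType).
Variables (m1 : {measure set T1 -> \bar R}) (m2 : {measure set T2 -> \bar R}).
Variables (f1 : T1 -> Y) (f2 : T2 -> Y).
Hypotheses (mf1 : measurable_fun setT f1) (mf2 : measurable_fun setT f2).
Variables (u : T1 -> \bar R) (v : T2 -> \bar R).
Hypotheses (mu : measurable_fun setT u) (mv : measurable_fun setT v).
Hypotheses (u0 : forall x, 0 <= u x) (v0 : forall x, 0 <= v x).
Hypothesis uv : forall B, measurable B ->
  \int[m1]_(x in f1 @^-1` B) u x <= \int[m2]_(x in f2 @^-1` B) v x.

Import HBNNSimple.

Lemma integral_nnsfun_weight d (T : measurableType d)
    (m : {measure set T -> \bar R}) (f : T -> Y) (w : T -> \bar R)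
    (h : {nnsfun Y >-> R}) :
    measurable_fun setT f -> measurable_fun setT w -> (forall x, 0 <= w x) ->
  \int[m]_x ((h (f x))%:E * w x) =
  \sum_(y \in range h) y%:E * \int[m]_(x in f @^-1` (h @^-1` [set y])) w x.
Proof.
move=> mf mw w0.
have mpre y : measurable (f @^-1` (h @^-1` [set y])).
  by rewrite -[X in measurable X]setTI; apply: mf.
transitivity (\int[m]_x (\sum_(y \in range h)
    (y%:E * ((\1_(f @^-1` (h @^-1` [set y])) x)%:E * w x)))).
  apply: eq_integral => x _; rewrite fimfunE -fsumEFin//.
  rewrite ge0_mule_fsuml => [|y]; last exact: nnfun_muleindic_ge0.
  by apply: eq_fsbigr => y _; rewrite EFinM muleA.
have mi y : measurable_fun setT
    (fun x => (\1_(f @^-1` (h @^-1` [set y])) x)%:E * w x).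
  apply: emeasurable_funM => //; apply/measurable_EFinP.
  exact: measurable_indic.
rewrite ge0_integral_fsum//; last 2 first.
- by move=> y; apply: emeasurable_funM.
- move=> y x _; have [hy|hy] := leP 0%R y.
    by rewrite !mule_ge0// lee_fin.
  rewrite indicE memNset ?mul0e ?mule0//= => hfx.
  by move: hy; rewrite -hfx ltNge => /negP; apply.
apply: eq_fsbigr => y /[!inE] -[z _ <-].
rewrite ge0_integralZl// ?lee_fin//; last by move=> x _; rewrite mule_ge0// lee_fin.
congr (_ * _); rewrite [RHS]integral_mkcond; apply: eq_integral => x _.
by rewrite /patch indicE; case: ifP; rewrite ?mul1e ?mul0e.
Qed.

(** Both integrals are limits along the same simple functions [a n], for which the claim is a
    nonnegative combination of instances of [uv]. Used in both directions, it extends equalities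
    from sets to functions. *)
Lemma le_integral_weight (h : Y -> \bar R) :
    measurable_fun setT h -> (forall y, 0 <= h y) ->
  \int[m1]_x (h (f1 x) * u x) <= \int[m2]_x (h (f2 x) * v x).
Proof.
move=> mh h0; pose a := nnsfun_approx measurableT mh.
have lim d (T : measurableType d) (m : {measure set T -> \bar R})
    (f : T -> Y) (w : T -> \bar R) : measurable_fun setT f ->
    measurable_fun setT w -> (forall x, 0 <= w x) ->
    \int[m]_x ((a n (f x))%:E * w x) @[n --> \oo] --> \int[m]_x (h (f x) * w x).
  move=> mf mw w0.
  rewrite (_ : (fun x => h (f x) * w x) =
      fun x => limn (fun n => (a n (f x))%:E * w x)).
    apply: cvg_monotone_convergence => //.
    - move=> n; apply: emeasurable_funM => //; apply/measurable_EFinP.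
      exact: measurableT_comp.
    - by move=> n x _; rewrite mule_ge0// lee_fin.
    - move=> x _ i j ij; rewrite lee_wpmul2r// lee_fin.
      exact/lefP/nd_nnsfun_approx.
  apply/funext => x; apply/esym/cvg_lim => //.
  have ah : (a n (f x))%:E @[n --> \oo] --> h (f x).
    exact: (cvg_nnsfun_approx measurableT mh (fun y _ => h0 y)).
  (* Where the weight is [+oo], the product passes to the limit if [h (f x) != 0]; if [h (f x) = 0],
     the approximants vanish as well, being below [h]. *)
  have [wy|wy] := eqVneq (w x) +oo; last first.
    by apply: cvgeZr => //; rewrite ge0_fin_numE// ltey.
  have [hx0|hx0] := eqVneq (h (f x)) 0.
    rewrite hx0 mul0e; rewrite (_ : (fun n => _) = cst 0); first exact: cvg_cst.
    apply/funext => n /=; rewrite (_ : a n (f x) = 0%R) ?mul0e//.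
    apply/eqP; rewrite eq_le; apply/andP; split; last by [].
    rewrite -lee_fin -[leRHS]hx0 -(cvg_lim _ ah)//.
    apply: lime_ge; first by apply/cvg_ex; exists (h (f x)).
    by exists n => // k /= nk; rewrite lee_fin; exact/lefP/nd_nnsfun_approx.
  apply: cvgeM => //; last exact: cvg_cst.
  by rewrite wy; apply: mule_def_neq0_infty.
rewrite -(cvg_lim _ (lim _ _ m1 _ _ mf1 mu u0))//.
rewrite -(cvg_lim _ (lim _ _ m2 _ _ mf2 mv v0))//.
apply: lee_lim.
- by apply/cvg_ex; eexists; exact: lim.
- by apply/cvg_ex; eexists; exact: lim.
apply: nearW => n; rewrite !integral_nnsfun_weight//.
apply: lee_fsum => // y [z _ <-].
by rewrite lee_wpmul2l ?lee_fin//; exact: uv.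
Qed.

End integral_weight.

(** * Existence of conditional expectations of nonnegative functions *)

Section conditional_version.
Context d d' (T : measurableType d) (Y : measurableType d') (R : realType).
Variables (P : probability T R) (phi : T -> Y).
Hypothesis mphi : measurable_fun setT phi.

Let mpre B : measurable B -> measurable (phi @^-1` B).
Proof. by move=> mB; rewrite -[X in measurable X]setTI; apply: mphi. Qed.

Section integrable_density.
Variable f : T -> \bar R.
Hypotheses (mf : measurable_fun setT f) (f0 : forall x, 0 <= f x).
Hypothesis fy : \int[P]_x f x < +oo.

Definition push_density (B : set Y) := \int[P]_(x in phi @^-1` B) f x.

Let push0 : push_density set0 = 0.
Proof. by rewrite /push_density preimage_set0 integral_set0. Qed.

Let push_ge0 B : 0 <= push_density B.
Proof. exact: integral_ge0. Qed.

Let push_sigma_additive : semi_sigma_additive push_density.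
Proof.
move=> F mF tF mUF; rewrite /push_density preimage_bigcup.
apply: (semi_sigma_additive_nng_induced mf f0) => //.
- by move=> n; exact: mpre.
- move=> i j _ _ [x [Fi Fj]]; apply: (tF i j) => //; by exists (phi x).
- by apply: bigcup_measurable => n _; exact: mpre.
Qed.

(** [g] is the Radon-Nikodym derivative of [push_density] with respect to the law of [phi], that is,
    the map sending [y] to [E[f | phi = y]]. *)
Lemma integrable_cond_version : exists g : Y -> \bar R,
  [/\ measurable_fun setT g, forall y, 0 <= g y &
  forall B, measurable B ->
    \int[P]_(x in phi @^-1` B) g (phi x) = \int[P]_(x in phi @^-1` B) f x].
Proof.
pose nu_mixin := isMeasure.Build _ _ _ push_density push0 push_ge0 push_sigma_additive.
pose nu : {measure set Y -> \bar R} := HB.pack push_density nu_mixin.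
have nufin : fin_num_fun nu.
  move=> B mB; rewrite ge0_fin_numE; last exact: push_ge0.
  apply: le_lt_trans fy; apply: ge0_subset_integral => //; exact: mpre.
pose nuf_mixin := Measure_isFinite.Build _ _ _ nu nufin.
pose nuf : {finite_measure set Y -> \bar R} := HB.pack push_density nu nuf_mixin.
pose phi_mixin := isMeasurableFun.Build _ _ _ _ _ mphi.
pose mfphi : {mfun T >-> Y} := HB.pack phi phi_mixin.
have dom : nuf `<< distribution P mfphi.
  apply/null_content_dominatesP => B mB PB0.
  by apply: null_set_integral => //; [exact: mpre|exact: measurable_funTS].
have [g [g0 gfin ig gE]] := radon_nikodym_sigma_finite dom.
have mg := measurable_int _ ig.
exists g; split => // B mB.
transitivity (nuf B) => //; rewrite (gE B mB).
by rewrite [RHS](ge0_integral_pushforward mphi)//; exact: measurable_funTS.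
Qed.

End integrable_density.

Import HBNNSimple.

(** A nonnegative [f] is the sum of the increments of its simple approximation; each increment is
    integrable, and their conditional versions are summed. *)
Lemma ge0_cond_version (f : T -> \bar R) :
    measurable_fun setT f -> (forall x, 0 <= f x) ->
  exists g : Y -> \bar R,
  [/\ measurable_fun setT g, forall y, 0 <= g y &
  forall B, measurable B ->
    \int[P]_(x in phi @^-1` B) g (phi x) = \int[P]_(x in phi @^-1` B) f x].
Proof.
move=> mf f0; pose a := nnsfun_approx measurableT mf.
(* The shift makes the sequence start at 0, so that the increments [b] telescope. *)
pose s n x : R := if n is n'.+1 then a n' x else 0%R.
pose b n x := ((s n.+1 x - s n x)%R)%:E.
have s_nd n x : (s n x <= s n.+1 x)%R.
  by case: n => [|n] /=; [exact: fun_ge0|exact/lefP/(nd_nnsfun_approx measurableT mf)].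
have ms n : measurable_fun setT (s n) by case: n => [|n]; [exact: measurable_cst|].
have mb n : measurable_fun setT (b n).
  by apply/measurable_EFinP; exact: measurable_funB.
have b0 n x : 0 <= b n x by rewrite lee_fin subr_ge0.
have bsum x : \sum_(n <oo) b n x = f x.
  apply: cvg_lim => //.
  rewrite (_ : (fun n => _) = (fun n => (s n x)%:E)); last first.
    apply/funext => n; rewrite sumEFin telescope_sumr// subr0//.
  rewrite -(cvg_shiftS (fun n => (s n x)%:E)).
  exact: (cvg_nnsfun_approx measurableT mf (fun y _ => f0 y)).
have by_ n : \int[P]_x b n x < +oo.
  apply: (@le_lt_trans _ _ (\int[P]_x (a n x)%:E)).
    apply: ge0_le_integral => //; first by apply/measurable_EFinP.
    move=> x _; rewrite lee_fin lerBlDr lerDl.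
    by case: n {b0 mb} => [|n] /=.
  have : P.-integrable setT (EFin \o a n).
    apply: measurable_bounded_integrable => //; first exact: fin_num_fun_lty.
    exact: simple_bounded.
  by move/integrable_lty; exact.
have [g gP] := choice (fun n => integrable_cond_version (mb n) (b0 n) (by_ n)).
have mg n : measurable_fun setT (g n) by have [] := gP n.
have g0 n y : 0 <= g n y by have [_ + _] := gP n; exact.
exists (fun y => \sum_(n <oo) g n y); split.
- by apply: (@ge0_emeasurable_sum _ _ _ _ _ xpredT).
- by move=> y; exact: nneseries_ge0.
move=> B mB; rewrite integral_nneseries//; last first.
- move=> n; apply: measurable_funTS; exact: measurableT_comp.
- exact: mpre.
transitivity (\int[P]_(x in phi @^-1` B) \sum_(n <oo) b n x); last first.
  by apply: eq_integral => x _; exact: bsum.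
rewrite integral_nneseries//; last first.
- move=> n; exact: measurable_funTS.
- exact: mpre.
by apply: eq_eseriesr => n _; have [_ _ ->] := gP n.
Qed.

End conditional_version.

(** * Tangent inequalities and slopes of powers *)

Section log_bounds.
Context {R : realType}.
Implicit Types x y a b c s : R.

Lemma powR_expR x b : (0 < x)%R -> (x `^ b)%R = expR (b * ln x).
Proof. by move=> x0; rewrite /powR gt_eqF. Qed.

(** This is [exp u >= 1 + u] at [u = b log x - c]. With [exp c] a bound on the mean of [x^b],
    integration gives Jensen's inequality. *)
Lemma lne_le_tangent x b c : (0 < b)%R -> (0 <= x)%R ->
  lne x%:E <= ((x `^ b * expR (- c) - 1 + c) / b)%:E.
Proof.
move=> b0; rewrite le_eqVlt => /predU1P[<-|x0]; first by rewrite le0_lneNy// leNye.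
rewrite lne_EFin// lee_fin ler_pdivlMr// powR_expR//.
by have := expR_ge1Dx (b * ln x - c); rewrite expRD; lra.
Qed.

Lemma powR_slope_le x a b : (0 <= x)%R -> (0 < a)%R -> (a <= b)%R ->
  ((x `^ a - 1) / a <= (x `^ b - 1) / b)%R.
Proof.
move=> x0 a0 ab; have b0 : (0 < b)%R by exact: lt_le_trans ab.
move: x0; rewrite le_eqVlt => /predU1P[<-|x0].
  rewrite !powR0 ?gt_eqF// !sub0r !mulN1r lerN2.
  by rewrite lef_pV2// posrE.
rewrite !powR_expR// ler_pdivrMr// mulrAC ler_pdivlMr//.
set l := ln x; have e0 := expR_gt0 (a * l).
have h1 : (expR (b * l) >= expR (a * l) * (1 + (b - a) * l))%R.
  rewrite (_ : (b * l = a * l + (b - a) * l)%R) ?expRD; last by ring.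
  by rewrite ler_pM2l// expR_ge1Dx.
have h2 : (1 >= expR (a * l) * (1 - a * l))%R.
  rewrite -[leRHS](_ : (expR (a * l) * expR (- (a * l)) = 1)%R); last first.
    by rewrite -expRD subrr expR0.
  by rewrite ler_pM2l// expR_ge1Dx.
(* With weights [a] and [b - a], the two tangents combine to [a (x^b - x^a) >= a (b - a) l x^a >= (b
   - a) (x^a - 1)], which is the claim. *)
have := ler_wpM2l (ltW a0) h1.
have ba0 : (0 <= b - a)%R by rewrite subr_ge0.
have := ler_wpM2l ba0 h2.
nra.
Qed.

Lemma powR_slope_cvg x : (0 <= x)%R ->
  ((x `^ n.+1%:R^-1 - 1) / n.+1%:R^-1)%:E @[n --> \oo] --> lne x%:E.
Proof.
rewrite le_eqVlt => /predU1P[<-|x0].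
  rewrite le0_lneNy//.
  under eq_fun do rewrite powR0 ?invr_eq0// sub0r mulN1r invrK.
  apply/cvgeNyPle => M; exists (Num.truncn (- M)) => // n /= Mn.
  by rewrite lee_fin lerNl (le_trans (ltW (truncnS_gt _)))// ler_nat.
rewrite lne_EFin//; apply: cvg_EFin; first by near=> n.
have b0 n : (0 < n.+1%:R^-1 :> R)%R by rewrite invr_gt0.
(* At [b = 1/(n+1)] the slope lies between [log x] and [x^b log x], by [exp u >= 1 + u] at
   [u = b log x] and at [u = - b log x]. *)
apply: (@squeeze_cvgr _ _ _ _ (cst (ln x)) (fun n => expR (n.+1%:R^-1 * ln x) * ln x)%R).
- near=> n => /=; move: (b0 n); move: (n.+1%:R^-1)%R => b {}b0.
  rewrite powR_expR// ler_pdivlMr// ler_pdivrMr//; set l := ln x.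
  have := expR_ge1Dx (b * l); have := expR_ge1Dx (- (b * l)).
  have e1 : (expR (b * l) * expR (- (b * l)) = 1)%R by rewrite -expRD subrr expR0.
  move=> /(ler_wpM2l (ltW (expR_gt0 (b * l)))); rewrite e1.
  by move: (expR (b * l)) => e h1 h2; apply/andP; split; lra.
- exact: cvg_cst.
have e1 : expR (n.+1%:R^-1 * ln x)%R @[n --> \oo] --> expR (0 * ln x).
  apply: continuous_cvg; first exact: continuous_expR.
  by apply: cvgMr_tmp; exact: cvg_harmonic.
by rewrite -[X in _ --> X]mul1r; apply: cvgMr_tmp; move: e1; rewrite mul0r expR0.
Unshelve. all: by end_near. Qed.

End log_bounds.

Lemma lte_expR_lne (R : realType) (a : R) (x : \bar R) :
  (a%:E < lne x) = ((expR a)%:E < x).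
Proof.
case: x => [x| |]//=; rewrite ?ltry//.
have [x0|x0] := leP x 0%R.
  by rewrite lte_fin [RHS]le_gtF ?(le_trans x0) ?expR_ge0.
by rewrite !lte_fin -ltr_expR lnK// posrE.
Qed.

Lemma lee_expR_lne (R : realType) (a : R) (x : \bar R) :
  (a%:E <= lne x) = ((expR a)%:E <= x).
Proof.
case: x => [x| |]//=; rewrite ?leey//.
have [x0|x0] := leP x 0%R.
  by rewrite lee_fin [RHS]lt_geF ?(le_lt_trans x0) ?expR_gt0.
by rewrite !lee_fin -ler_expR lnK// posrE.
Qed.

Lemma lee_lne_expR (R : realType) (a : R) (x : \bar R) :
  (lne x <= a%:E) = (x <= (expR a)%:E).
Proof. by rewrite !leNgt lte_expR_lne. Qed.

Lemma emeasurable_lne (R : realType) : measurable_fun setT (@lne R).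
Proof.
move=> mT; apply: (measurability _ (ErealGenOInfty.measurableE R)) => //.
move=> _ [_ [r ->] <-]; rewrite setTI.
rewrite (_ : _ @^-1` _ = `](expR r)%:E, +oo[%classic); first exact: emeasurable_itv.
by apply/seteqP; split => x /=; rewrite !in_itv/= !andbT lte_expR_lne.
Qed.

(** * Logarithmic and power integrals over one set *)

Section real_density.
Context d (T : measurableType d) (R : realType).
Variables (P : {measure set T -> \bar R}) (r : T -> R) (B : set T).
Hypotheses (mr : measurable_fun setT r) (r0 : forall x, (0 <= r x)%R).
Hypothesis mB : measurable B.

Hypothesis PBfin : P B \is a fin_num.

Let ic k : P.-integrable B (cst k%:E).
Proof.
apply: (@measurable_bounded_integrable _ _ _ P (cst k) B) => //.
  by rewrite -ge0_fin_numE.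
exists `|k|%R; split; first exact: num_real.
by move=> M kM x _; exact: ltW.
Qed.

Lemma measurable_powR_comp b : measurable_fun B (fun x => (r x `^ b)%R).
Proof.
by apply: measurable_funTS; exact: (measurableT_comp (@measurable_powR R b)).
Qed.

Lemma measurable_lne_comp : measurable_fun B (fun x => lne (r x)%:E).
Proof.
apply: measurable_funTS; apply: (measurableT_comp (@emeasurable_lne R)).
exact/measurable_EFinP.
Qed.

Lemma integral_lne_le b c : (0 < b)%R ->
    \int[P]_(x in B) (r x `^ b)%:E <= (expR c)%:E * P B ->
  \int[P]_(x in B) lne (r x)%:E <= (c / b)%:E * P B.
Proof.
move=> b0 Zc; have mrb := measurable_powR_comp b.
have iZ : P.-integrable B (fun x => (r x `^ b)%:E).
  apply: ge0_fin_integrable => //; first exact/measurable_EFinP.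
  - by move=> x _; rewrite lee_fin powR_ge0.
  - by rewrite (le_lt_trans Zc)// -ge0_fin_numE ?fin_numM// mule_ge0// lee_fin expR_ge0.
(* The tangent bound is [k1 r^b + k2]; it takes the value [c / b] at [r^b = exp c]. *)
pose k1 := (expR (- c) / b)%R; pose k2 := ((c - 1) / b)%R.
have k10 : (0 <= k1)%R by rewrite divr_ge0 ?expR_ge0// ltW.
have ik2 : P.-integrable B (cst k2%:E) by exact: ic.
apply: (@le_trans _ _ (\int[P]_(x in B) (k1%:E * (r x `^ b)%:E + k2%:E))).
  apply: ae_le_integral => //.
  - exact: measurable_lne_comp.
  - apply: emeasurable_funD => //; apply: emeasurable_funM => //.
    exact/measurable_EFinP.
  - apply: aeW => x _; apply: le_trans (lne_le_tangent c b0 (r0 x)) _.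
    rewrite -EFinM -EFinD lee_fin /k1 /k2 le_eqVlt; apply/orP; left; apply/eqP.
    by field; rewrite gt_eqF.
rewrite integralD//; last exact: integrableZl.
rewrite integralZl// integral_cst//.
apply: (@le_trans _ _ (k1%:E * ((expR c)%:E * P B) + k2%:E * P B)).
  by rewrite leeD2r// lee_wpmul2l.
rewrite -(fineK PBfin) -!EFinM -EFinD lee_fin /k1 /k2 expRN.
rewrite le_eqVlt; apply/orP; left; apply/eqP.
by field; rewrite !gt_eqF// expR_gt0.
Qed.

Hypothesis ir : P.-integrable B (fun x => (r x)%:E).

Lemma integrable_powR b : (0 < b <= 1)%R ->
  P.-integrable B (fun x => (r x `^ b)%:E).
Proof.
move=> /andP[b0 b1]; apply: (@le_integrable _ _ _ _ _ mB _ (fun x => 1 + (r x)%:E)).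
- exact/measurable_EFinP/measurable_powR_comp.
- move=> x _; rewrite !gee0_abs ?adde_ge0// ?lee_fin ?powR_ge0//.
  have [r1|/ltW r1] := leP 1%R (r x).
    by apply: (@le_trans _ _ (r x)); [rewrite ler1_powR|rewrite lerDr].
  rewrite (@le_trans _ _ 1%R)// ?lerDl//.
  have := @ge0_ler_powR _ b (ltW b0) (r x) 1%R.
  by rewrite powR1; apply; rewrite ?nnegrE.
- apply: integrableD => //; exact: ic.
Qed.

Lemma integrable_slope b : (0 < b <= 1)%R ->
  P.-integrable B (fun x => ((r x `^ b - 1) / b)%:E).
Proof.
move=> b01.
apply: (@eq_integrable _ _ _ _ _ _ (fun x => (b^-1)%:E * ((r x `^ b)%:E - 1))) => //.
  by move=> x _; rewrite -EFinB -EFinM mulrC.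
apply: integrableZl => //; apply: integrableB => //; first exact: integrable_powR.
exact: ic.
Qed.

(** If no slope had integral below [m], monotone convergence for the nonnegative functions
    [r - q n], which increase to [r - log r], would bound the integral of [log r] below by [m]. *)
Lemma integral_slope_lt m : \int[P]_(x in B) lne (r x)%:E < m%:E ->
  exists n, \int[P]_(x in B) ((r x `^ n.+1%:R^-1 - 1) / n.+1%:R^-1)%:E < m%:E.
Proof.
move=> lnm; apply/not_existsP => nm.
pose q n x : R := ((r x `^ n.+1%:R^-1 - 1) / n.+1%:R^-1)%R.
have n01 n : (0 < (n.+1%:R^-1 : R) <= 1)%R.
  by rewrite invr_gt0 ltr0n/= invf_le1// ler1n.
have qm n : m%:E <= \int[P]_(x in B) (q n x)%:E by rewrite leNgt; apply/negP/nm.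
have q_ni x i j : (i <= j)%N -> (q j x <= q i x)%R.
  move=> ij; apply: powR_slope_le => //.
  by rewrite lef_pV2 ?posrE// ler_nat.
(* The slope at exponent 1 is [r - 1], and the others are smaller. *)
have qr n x : (q n x <= r x)%R.
  apply: le_trans (q_ni x _ _ (leq0n n)) _.
  by rewrite /q invr1 powRr1// divr1 lerBlDr lerDl.
have iq n : P.-integrable B (fun x => (q n x)%:E) by exact: integrable_slope.
have mrE : measurable_fun B (fun x => (r x)%:E).
  by apply: measurable_funTS; exact/measurable_EFinP.
have mk n : measurable_fun B (fun x => (r x)%:E - (q n x)%:E).
  by apply: emeasurable_funB => //; exact: measurable_int (iq n).
have k0 n x : B x -> 0 <= (r x)%:E - (q n x)%:E.
  by move=> _; rewrite -EFinB lee_fin subr_ge0.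
have cvgk x : (r x)%:E - (q n x)%:E @[n --> \oo] --> (r x)%:E - lne (r x)%:E.
  apply: cvgeB; [by rewrite fin_num_adde_defr|exact: cvg_cst|].
  exact: powR_slope_cvg.
have rl : \int[P]_(x in B) ((r x)%:E - lne (r x)%:E) <=
    \int[P]_(x in B) (r x)%:E - m%:E.
  rewrite (_ : (fun x => _ - lne _) =
      fun x => limn (fun n => (r x)%:E - (q n x)%:E)); last first.
    by apply/funext => x; apply/esym/cvg_lim.
  rewrite monotone_convergence//; last first.
    move=> x _ i j ij; rewrite -!EFinB lee_fin lerD2l lerN2; exact: q_ni.
  apply: lime_le.
    apply: ereal_nondecreasing_is_cvgn => i j ij; apply: ge0_le_integral => //.
      exact: k0.
    by move=> x _; rewrite -!EFinB lee_fin lerD2l lerN2; exact: q_ni.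
  by apply: nearW => n; rewrite integralB// leeB.
suff : m%:E <= \int[P]_(x in B) lne (r x)%:E by rewrite leNgt lnm.
(* The integral of [log r] may be [-oo]; [r - (r - log r)] presents it as an integrable function
   minus a nonnegative one. *)
have rlE x : lne (r x)%:E = (r x)%:E - ((r x)%:E - lne (r x)%:E).
  by case: (lne _) => [a| |] //=; rewrite -?EFinB; congr (_%:E); lra.
have rl0 x : 0 <= (r x)%:E - lne (r x)%:E.
  have : lne (r x)%:E < (r x)%:E by exact: lne_sublinear.
  by case: (lne _) => [a| |]//=; rewrite ?leey// !lte_fin lee_fin; lra. 
under eq_integral do rewrite rlE.
rewrite integral_ge0B//;
  [|exact: emeasurable_funB mrE measurable_lne_comp|by move=> x _; rewrite lee_fin].
have : 0 <= \int[P]_(x in B) ((r x)%:E - lne (r x)%:E) by exact: integral_ge0.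
move: rl; rewrite -(fineK (integrable_fin_num mB ir)).
case: (\int[P]_(x in B) _) => [a| |]//.
by rewrite -!EFinB !lee_fin => h _; lra.
Qed.

(** One slope with integral below [m] suffices: slopes decrease with the exponent, so the strict
    inequality persists for all smaller [b]. *)
Lemma integral_powR_lt m : \int[P]_(x in B) lne (r x)%:E < m%:E ->
  exists2 e : R, (0 < e <= 1)%R & forall b, (0 < b <= e)%R ->
    \int[P]_(x in B) (r x `^ b)%:E < P B + (b * m)%:E.
Proof.
move=> /integral_slope_lt[n nm]; exists (n.+1%:R^-1)%R.
  by rewrite invr_gt0 ltr0n/= invf_le1// ler1n.
move=> b /andP[b0 bn].
have b1 : (b <= 1)%R by rewrite (le_trans bn)// invf_le1// ler1n.
have b01 : (0 < b <= 1)%R by rewrite b0.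
have n01 : (0 < (n.+1%:R^-1 : R) <= 1)%R.
  by rewrite invr_gt0 ltr0n/= invf_le1// ler1n.
have : \int[P]_(x in B) ((r x `^ b - 1) / b)%:E < m%:E.
  apply: le_lt_trans nm; apply: le_integral => //; try exact: integrable_slope.
  by move=> x _; rewrite lee_fin powR_slope_le.
under eq_integral do rewrite mulrC EFinM EFinB.
rewrite integralZl//; last first.
  apply: integrableB => //; first exact: integrable_powR.
  exact: ic.
rewrite integralB//; last 2 first.
- exact: integrable_powR.
- exact: ic.
rewrite integral_cst// mul1e.
have Zfin := integrable_fin_num mB (integrable_powR b01).
rewrite -(fineK PBfin) -(fineK Zfin) -EFinB -EFinM -EFinD !lte_fin => h.
by rewrite -ltrBlDl -ltr_pdivrMl.
Qed.


Lemma measurable_poweR_inv s (E : T -> \bar R) : measurable_fun setT E ->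
    (forall x, 0 <= E x) ->
  measurable_fun setT (fun x => (E x `^ s)^-1).
Proof.
move=> mE E0.
rewrite (_ : (fun x => _) = fun x => if s == 0%R then 1 else
  if E x == +oo then 0 else
  if E x == 0 then +oo else (fine (E x) `^ (- s))%:E); last first.
  apply/funext => x; have [->|s0] := eqVneq s 0%R; first by rewrite poweRe0 inve1.
  have := E0 x; case: (E x) => [a| |]//; last by rewrite poweRyr// invey.
  rewrite lee_fin le_eqVlt => /predU1P[<-|a0].
    by rewrite eqxx poweR0r// inve0.
  by rewrite poweR_EFin inver powR_eq0 eqe gt_eqF//= powRN.
have [_|_] := eqVneq s 0%R; first exact: measurable_cst.
apply: measurable_fun_ifT; [exact: measurable_fun_eqe|exact: measurable_cst|].
apply: measurable_fun_ifT; [exact: measurable_fun_eqe|exact: measurable_cst|].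
apply/measurable_EFinP; apply: (measurableT_comp (@measurable_powR R (- s))).
exact: measurableT_comp.
Qed.

Lemma poweR_inv_ge0 s (x : \bar R) : 0 <= (x `^ s)^-1.
Proof. by rewrite inve_ge0 poweR_ge0. Qed.

(** In the integral of [exp (- l) (1 + l + log r + s (1 - E))], [log r] contributes at least
    [- l P B] and [s (1 - E)] at least 0, which leaves at least [exp (- l) P B]. *)
Lemma integral_wealth_ge l s (E : T -> \bar R) : (0 <= s)%R ->
    measurable_fun setT E -> (forall x, 0 <= E x) ->
    \int[P]_(x in B) E x <= P B ->
    - (l%:E * P B) <= \int[P]_(x in B) lne (r x)%:E ->
  (expR (- l))%:E * P B <= \int[P]_(x in B) ((E x `^ s)^-1 * (r x)%:E).
Proof.
move=> s0 mE E0 EB lB.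
have mrE : measurable_fun setT (fun x => (r x)%:E) by exact/measurable_EFinP.
have iE : P.-integrable B E.
  apply: ge0_fin_integrable => //; first exact: measurable_funTS.
  by rewrite (le_lt_trans EB)// -ge0_fin_numE.
have il : P.-integrable B (fun x => lne (r x)%:E).
  apply: (integrable_of_le mB measurable_lne_comp ir).
    by move=> x _; apply/ltW/lne_sublinear.
  by rewrite (lt_le_trans _ lB)// -(fineK PBfin) -EFinM -EFinN ltNye.
pose c := expR (- l).
have tangent x : c%:E * (lne (r x)%:E + (1 + l + s)%:E - s%:E * E x) <=
    (E x `^ s)^-1 * (r x)%:E.
  (* At [r = 0] the left side is [-oo]; settling this case also removes the product [+oo * 0] that
     arises on the right when [E = 0]. *)
  have := r0 x; rewrite le_eqVlt => /predU1P[<-|rx0].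
    rewrite le0_lneNy// mule0 [leLHS](_ : _ = c%:E * -oo)// gt0_muleNy ?leNye//.
    by rewrite lte_fin expR_gt0.
  rewrite lne_EFin// -EFinD.
  (* Here [y] stands for [log E]: this is [exp u >= 1 + u] at [u = l + log r - s y], multiplied by
     [exp (- l)]. *)
  have real_tangent y : (c * (ln (r x) + (1 + l + s) - s - s * y) <=
      expR (- (s * y)) * r x)%R.
    have := expR_ge1Dx (l + ln (r x) - s * y).
    move/(ler_wpM2l (expR_ge0 (- l))); rewrite -expRD.
    rewrite (_ : (- l + (l + ln (r x) - s * y) = - (s * y) + ln (r x))%R); last by ring.
    have <- : (expR (- (s * y) + ln (r x)) = expR (- (s * y)) * r x)%R.
      by rewrite expRD lnK ?posrE.
    by apply: le_trans; rewrite /c ler_pM2l ?expR_gt0//; lra.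
  (* At [s = 0], [E^(-s) = 1] and [s E = 0] hold even for [E = +oo], unlike the limits used below
     for [s > 0]. *)
  have [s00|sn0] := eqVneq s 0%R.
    have := real_tangent 0%R; rewrite s00 poweRe0 inve1 mul1e mul0e sube0.
    by rewrite -EFinM lee_fin !mul0r oppr0 expR0 mul1r !addr0.
  have sgt0 : (0 < s)%R by rewrite lt_neqAle eq_sym sn0.
  have := E0 x; case: (E x) => [e| |]//; last first.
    by rewrite gt0_muley ?lte_fin// addeNy gt0_muleNy ?leNye// lte_fin expR_gt0.
  rewrite lee_fin le_eqVlt => /predU1P[<-|e0].
    by rewrite poweR0r// inve0 gt0_mulye ?leey// lte_fin.
  rewrite poweR_EFin inver powR_eq0 (gt_eqF e0)/= -?EFinM -?EFinB -?EFinM lee_fin.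
  rewrite powR_expR// -expRN; apply: le_trans (real_tangent (ln e)).
  rewrite ler_pM2l ?expR_gt0//; have := expR_ge1Dx (ln e); rewrite lnK ?posrE// => he.
  have := ler_wpM2l s0 he; lra.
apply: (@le_trans _ _ (\int[P]_(x in B)
    (c%:E * (lne (r x)%:E + (1 + l + s)%:E - s%:E * E x)))); last first.
  apply: ae_le_integral => //; last exact: aeW.
  - apply: emeasurable_funM => //; apply: emeasurable_funB.
      by apply: emeasurable_funD => //; exact: measurable_lne_comp.
    by apply: measurable_funTS; apply: emeasurable_funM.
  - by apply: measurable_funTS; apply: emeasurable_funM => //; exact: measurable_poweR_inv.
have iA : P.-integrable B (fun x => lne (r x)%:E + (1 + l + s)%:E).
  by have := integrableD mB il (ic (1 + l + s)%R).
have iM : P.-integrable B (fun x => s%:E * E x) by exact: integrableZl.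
rewrite integralZl//; last exact: integrableB.
rewrite integralB// integralD//; last exact: ic.
rewrite integralZl// integral_cst// lee_wpmul2l ?lee_fin ?expR_ge0//.
move: EB lB; rewrite -(fineK PBfin) -(fineK (integrable_fin_num mB il)).
rewrite -(fineK (integrable_fin_num mB iE)) -!EFinM -!EFinN -!EFinD !lee_fin.
move=> EB /(lerD (ler_wpM2l s0 EB)); lra.
Qed.

End real_density.

(** * Conditional expectations on a filtration *)

Lemma measurable_ratio d (T : measurableType d) (R : realType) (a b : T -> R) :
    measurable_fun setT a -> measurable_fun setT b ->
  measurable_fun setT (fun w => if (0 < b w)%R then (a w / b w)%R else 1%R).
Proof.
move=> ma mb.
rewrite (_ : (fun w => _) =
    fun w => if (0 < b w)%R then (a w * (b w `^ (-1)))%R else 1%R); last first.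
  by apply/funext => w; case: ifPn => // /ltW b0; rewrite powR_inv1.
apply: measurable_fun_ifT => //; first exact: measurable_fun_ltr.
apply: measurable_funM => //.
exact: (measurableT_comp (@measurable_powR R (-1))).
Qed.

Lemma lte_rat_between (R : realType) (x y : \bar R) : x < y ->
  exists q : rat, x < (ratr q)%:E < y.
Proof.
have rat_in (a b : R) : (a < b)%R -> exists q : rat, a%:E < (ratr q)%:E < b%:E.
  by move=> /rat_in_itvoo[q]; rewrite in_itv/= => qab; exists q; rewrite !lte_fin.
case: x y => [a| |] [b| |]//.
- by rewrite lte_fin; exact: rat_in.
- have /rat_in[q /andP[aq _]] : (a < a + 1)%R by rewrite ltrDl.
  by exists q; rewrite aq ltry.
- have /rat_in[q /andP[_ qb]] : (b - 1 < b)%R by rewrite gtrBl.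
  by exists q; rewrite qb ltNyr.
- by exists 0%R; rewrite ltry ltNyr.
Qed.

Section stage.
Context d (T : measurableType d) (R : realType) (F : filtration T).
Implicit Types (f g : T -> \bar R) (t : nat) (A D : set T).

Lemma stage_measurableE t :
  (measurable : set (set (g_sigma_algebraType (F t)))) = F t.
Proof. exact: sigma_algebra_id (sigma_at_sigma F t). Qed.

Lemma stage_measurable t A : F t A -> measurable A.
Proof. exact: sigma_at_sub. Qed.

Lemma measurable_to_stage t : measurable_fun setT (@to_stage _ _ F t).
Proof. exact: measurable_funP. Qed.

Lemma measurable_wrt_measurable t f : measurable_wrt (F t) f ->
  measurable_fun setT f.
Proof.
move=> mf _ B mB; have := mf measurableT B mB.
by rewrite stage_measurableE; exact: sigma_at_sub.
Qed.

Lemma stage_measurable_mono s t d' (Y : measurableType d') (f : T -> Y) :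
    (s <= t)%N ->
  measurable_fun setT (f : g_sigma_algebraType (F s) -> Y) ->
  measurable_fun setT (f : g_sigma_algebraType (F t) -> Y).
Proof.
move=> st mf _ B mB; have := mf measurableT B mB.
by rewrite !stage_measurableE; exact: sigma_at_mono.
Qed.

Lemma stage_setI t A D : F t A -> F t D -> F t (A `&` D).
Proof. by rewrite -stage_measurableE => mA mD; exact: measurableI. Qed.

Lemma stage_lee t f g : measurable_wrt (F t) f -> measurable_wrt (F t) g ->
  F t [set w | f w <= g w].
Proof.
move=> mf mg; rewrite -stage_measurableE -[X in measurable X]setTI.
exact: measurable_lee.
Qed.

Lemma stage_between t D f g (a b : R) : F t D -> measurable_wrt (F t) f ->
    measurable_wrt (F t) g ->
  F t [set w | [/\ D w, b%:E <= f w & g w <= a%:E]].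
Proof.
move=> FD mf mg.
rewrite (_ : [set w | _] = D `&` ([set w | b%:E <= f w] `&`
    [set w | g w <= a%:E])); last first.
  by apply/seteqP; split=> [w []|w [? []]].
apply: stage_setI => //; apply: stage_setI; apply: stage_lee => //;
  exact: measurable_cst.
Qed.

Lemma stage_setT t : F t setT.
Proof. by rewrite -stage_measurableE; exact: measurableT. Qed.

Variable P : probability T R.

(** The set where [g < f] is covered by countably many sets of the hypothesis, one for each pair of
    rationals. [N] lies in [F t] so that absolute continuity on this stage can carry it to another
    measure. *)
Lemma stage_ae_le t D f g : F t D -> measurable_wrt (F t) f ->
    measurable_wrt (F t) g ->
    (forall a b : R, (a < b)%R ->
      P [set w | [/\ D w, b%:E <= f w & g w <= a%:E]] = 0) ->
  exists N, [/\ F t N, P N = 0 & forall w, D w -> ~ N w -> f w <= g w].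
Proof.
move=> FD mf mg fgD; exists (D `&` [set w | g w < f w]).
have FN : F t (D `&` [set w | g w < f w]).
  apply: stage_setI => //; rewrite -stage_measurableE -[X in measurable X]setTI.
  exact: measurable_lte.
split => //; last by move=> w Dw /not_andP[//|/negP]; rewrite -leNgt.
(* Pairs of rationals are enumerated by their codes; numbers that code no pair, and pairs in the
   wrong order, give the empty set. *)
pose B n : set T := if unpickle n is Some (p, q) then
  if (ratr p < ratr q :> R)%R then
    [set w | [/\ D w, (ratr q)%:E <= f w & g w <= (ratr p)%:E]] else set0
  else set0.
have mB n : measurable (B n).
  rewrite /B; case: (unpickle n) => [[p q]|//]; case: ifPn => // _.
  by apply: (@stage_measurable t); exact: stage_between.
apply/negligibleP; first exact: stage_measurable FN.
apply: (@negligibleS _ _ _ _ (\bigcup_n B n)).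
  move=> w [Dw /= /lte_rat_between[p /andP[gp pf]]].
  have [q /andP[pq qf]] := lte_rat_between pf.
  exists (pickle (p, q)); first exact: I.
  rewrite /B pickleK -lte_fin pq.
  by split => //; exact: ltW.
apply: negligible_bigcup => n; apply/negligibleP => //.
rewrite /B; case: (unpickle n) => [[p q]|]; last exact: measure0.
by case: ifPn => [|_]; [exact: fgD|exact: measure0].
Qed.

(** On the set [B] where [b <= f] and [g <= a], the integrals give [b P B <= a P B], hence [P B = 0]
    when [a < b]. The real bounds on [B] replace integrability. *)
Lemma stage_ae_le_integral t D f g : F t D -> measurable_wrt (F t) f ->
    measurable_wrt (F t) g ->
    (forall A, F t A -> A `<=` D ->
      \int[P]_(w in A) f w <= \int[P]_(w in A) g w) ->
  exists N, [/\ F t N, P N = 0 & forall w, D w -> ~ N w -> f w <= g w].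
Proof.
move=> FD mf mg fgA; apply: stage_ae_le => // a b ab; set B := [set w | _].
have FB : F t B by exact: stage_between FD mf mg.
have mB := stage_measurable FB.
have PB : P B \is a fin_num by exact: fin_num_measure.
have bPa : b%:E * P B <= a%:E * P B.
  apply: (@le_trans _ _ (\int[P]_(w in B) f w)).
    apply: ae_cst_le_integral => //; last by apply: aeW => w [].
    exact: measurable_funTS (measurable_wrt_measurable mf).
  apply: (@le_trans _ _ (\int[P]_(w in B) g w)); first by apply: fgA => // w [].
  apply: ae_integral_le_cst => //; last by apply: aeW => w [].
  exact: measurable_funTS (measurable_wrt_measurable mg).
apply/eqP; rewrite eq_le; apply/andP; split; last exact: measure_ge0.
rewrite leNgt; apply/negP => P0; move: bPa; rewrite -(fineK PB) -!EFinM lee_fin.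
by rewrite ler_pM2r ?leNgt ?ab// fine_gt0// P0 ltey_eq PB.
Qed.

Lemma condexp_spec t f : (exists g, is_condexp P (F t) f g) ->
  is_condexp P (F t) f (condexp P (F t) f).
Proof.
by move=> fg; exact: (@xgetPex _ (cst 0) [set g | is_condexp P (F t) f g] fg).
Qed.

Lemma ge0_is_condexp t f : measurable_fun setT f -> (forall w, 0 <= f w) ->
  is_condexp P (F t) f (condexp P (F t) f).
Proof.
move=> mf f0; apply: condexp_spec.
have [g [mg g0 gE]] := ge0_cond_version P (@measurable_to_stage t) mf f0.
exists g; split => //.
- right; rewrite (eq_integral (cst 0)) ?integral0 ?ltry// => x _.
  by rewrite (@ge0_funenegE _ _ setT) ?inE.
- by move=> A FA; apply: gE; rewrite stage_measurableE.
Qed.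

(** The versions for the two parts are subtracted; that of [f^+] has a finite integral, so the
    integral of the difference splits even when that of [f^-] is infinite. *)
Lemma quasi_is_condexp t f : measurable_fun setT f ->
    \int[P]_w f^\+ w < +oo ->
  is_condexp P (F t) f (condexp P (F t) f).
Proof.
move=> mf fy; apply: condexp_spec.
have mfp : measurable_fun setT f^\+ by exact: measurable_funepos.
have mfn : measurable_fun setT f^\- by exact: measurable_funeneg.
have [g [mg g0 gE]] := ge0_cond_version P (@measurable_to_stage t) mfp (funepos_ge0 f).
have [h [mh h0 hE]] := ge0_cond_version P (@measurable_to_stage t) mfn (funeneg_ge0 f).
have mgT : measurable_fun setT (g : T -> \bar R) by exact: (@measurable_wrt_measurable t).
have mhT : measurable_fun setT (h : T -> \bar R) by exact: (@measurable_wrt_measurable t).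
exists (fun w => g w - h w); split => //; first by left.
- exact: emeasurable_funB.
move=> A FA; have mA := stage_measurable FA.
have mAt : measurable (A : set (g_sigma_algebraType (F t))).
  by rewrite stage_measurableE.
have gA := gE _ mAt; have hA := hE _ mAt.
rewrite integral_ge0B//.
- by rewrite [RHS]integralE; congr (_ - _).
- exact: measurable_funTS.
apply: ge0_fin_integrable => //; first exact: measurable_funTS.
rewrite [ltLHS]gA; apply: le_lt_trans fy.
exact: ge0_subset_integral.
Qed.

End stage.

Lemma negligible_bigcup_rat d (T : measurableType d) (R : realType)
    (mu : {measure set T -> \bar R}) (A : rat -> set T) :
  (forall q, mu.-negligible (A q)) -> mu.-negligible (\bigcup_q A q).
Proof.
move=> A0.
apply: (@negligibleS _ _ _ _ (\bigcup_n if unpickle n is Some q then A q else set0)).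
  by move=> w [q _ Aqw]; exists (pickle q); [exact: I|rewrite pickleK].
apply: negligible_bigcup => n; case: (unpickle n) => [q|]; first exact: A0.
exact: negligible_set0.
Qed.

Lemma measurable_ereal_sup_rat d (T : measurableType d) (R : realType)
    (p : pred rat) (f : rat -> T -> \bar R) :
    (forall q, p q -> measurable_fun setT (f q)) ->
  measurable_fun setT (fun w => ereal_sup [set f q w | q in [set q | p q]]).
Proof.
move=> mf mT; apply: (measurability _ (ErealGenOInfty.measurableE R)) => //.
move=> _ [_ [x ->] <-]; rewrite setTI.
rewrite (_ : _ @^-1` _ = \bigcup_q (if p q then f q @^-1` `]x%:E, +oo[ else set0)).
  apply: bigcupT_measurable_rat => q; case: ifPn => // pq.
  by rewrite -[X in measurable X]setTI; apply: mf => //; exact: emeasurable_itv.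
apply/seteqP; split => w /=; rewrite in_itv/= andbT.
  move=> /ereal_sup_gt[_ [q pq <-] xf]; exists q => //.
  by rewrite /= pq /= in_itv/= xf.
move=> [q _]; case: ifPn => //= pq; rewrite in_itv/= andbT => xf.
by apply: lt_le_trans xf _; apply: ereal_sup_ubound; exists q.
Qed.

(** * Limit of the rates as the exponent tends to zero *)

Section log_identity.
Context d (T : measurableType d) (R : realType) (F : filtration T) (t : nat).
Variables (P : probability T R) (r : T -> R).
Hypotheses (mr : measurable_fun setT r) (r0 : forall w, (0 <= r w)%R).
Hypothesis ir : P.-integrable setT (fun w => (r w)%:E).
Variables (Z : R -> T -> \bar R) (g : T -> \bar R).
Hypothesis mZ : forall b, (0 < b <= 1)%R -> measurable_wrt (F t) (Z b).
Hypothesis ZE : forall b A, (0 < b <= 1)%R -> F t A ->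
  \int[P]_(w in A) Z b w = \int[P]_(w in A) (r w `^ b)%:E.
Hypothesis mg : measurable_wrt (F t) g.
Hypothesis gE : forall A, F t A ->
  \int[P]_(w in A) g w = \int[P]_(w in A) lne (r w)%:E.

Let Pfin (B : set T) : measurable B -> P B \is a fin_num.
Proof. by move=> mB; exact: fin_num_measure. Qed.

(** On the set [B] where [c <= g] and [b^-1 log Z <= a], one has [Z <= exp (b a)], and Jensen's
    inequality bounds the integral of [g] by [a P B]; for [a < c] this makes [B] null. *)
Let jensen_upper b : (0 < b <= 1)%R -> exists N, [/\ F t N, P N = 0 &
  forall w, ~ N w -> g w <= (b^-1)%:E * lne (Z b w)].
Proof.
move=> b01; have /andP[b0 b1] := b01.
have mlZ : measurable_wrt (F t) (fun w => (b^-1)%:E * lne (Z b w)).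
  apply: emeasurable_funM; first exact: measurable_cst.
  exact: (measurableT_comp (@emeasurable_lne R) (mZ b01)).
suff [N [FN N0 Ng]] : exists N, [/\ F t N, P N = 0 & forall w, setT w -> ~ N w ->
    g w <= (b^-1)%:E * lne (Z b w)].
  by exists N; split => // w; exact: Ng.
apply: stage_ae_le => //; first exact: stage_setT.
move=> a c ac.
set B := [set w | _]; have FB' : F t B by exact: stage_between (stage_setT F t) mg mlZ.
have mB := stage_measurable FB'.
have ZB : \int[P]_(w in B) (r w `^ b)%:E <= (expR (b * a))%:E * P B.
  rewrite -ZE//; apply: ae_integral_le_cst => //.
    exact: measurable_funTS (measurable_wrt_measurable (mZ b01)).
  apply: aeW => w [_ _]; rewrite -lee_pdivlMl ?invr_gt0// invrK -EFinM.
  by rewrite lee_lne_expR.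
have := integral_lne_le mr r0 mB (Pfin mB) b0 ZB.
rewrite -gE// mulrC mulKf ?gt_eqF// => gB.
have : c%:E * P B <= a%:E * P B.
  apply: le_trans gB; apply: ae_cst_le_integral => //; last by apply: aeW => w [].
  exact: measurable_funTS (measurable_wrt_measurable mg).
have : 0 <= P B by exact: measure_ge0.
rewrite -(fineK (Pfin mB)) -!EFinM !lee_fin => p0 cap.
congr (_%:E); apply/eqP; rewrite eq_le p0 andbT leNgt; apply/negP => p1.
by move: cap; rewrite ler_pM2r// leNgt ac.
Qed.

Let lambda w := ereal_sup [set - ((((ratr q)^-1)%R)%:E * lne (Z (ratr q) w))
  | q in [set q : rat | (0 < q <= 1)%R]].

Let ratr01 (q : rat) : (0 < q <= 1)%R -> (0 < (ratr q : R) <= 1)%R.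
Proof. by move=> /andP[q0 q1]; rewrite ltr0q q0 -(ler_rat R) rmorph1 in q1 *. Qed.

Lemma measurable_rate : measurable_wrt (F t) lambda.
Proof.
apply: (@measurable_ereal_sup_rat _ (g_sigma_algebraType (F t)) R
  (fun q => 0 < q <= 1)%R) => q q01.
apply: measurableT_comp => //; apply: emeasurable_funM; first exact: measurable_cst.
exact: (measurableT_comp (@emeasurable_lne R) (mZ (ratr01 q01))).
Qed.

(** If the set [B] where [g <= a < c <= - lambda] had positive measure, the integral of [log r] over
    it would be less than [c P B], hence that of [r^q] less than [(1 + q c) P B] for a small
    rational [q]. But [c <= - lambda] forces [Z q >= exp (q c) >= 1 + q c] on [B]. *)
Let slope_lower : exists N, [/\ F t N, P N = 0 &
  forall w, ~ N w -> - lambda w <= g w].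
Proof.
suff [N [FN N0 Ng]] : exists N, [/\ F t N, P N = 0 & forall w, setT w -> ~ N w ->
    - lambda w <= g w].
  by exists N; split => // w; exact: Ng.
apply: stage_ae_le => //; [exact: stage_setT|exact: measurableT_comp measurable_rate|].
move=> a c ac; set B := [set w | _].
have FB' : F t B 
  by apply: stage_between => //; [exact: stage_setT|exact: measurableT_comp measurable_rate].
have mB := stage_measurable FB'.
have p0 : 0 <= P B by exact: measure_ge0.
have Pf := Pfin mB.
apply/eqP; rewrite eq_le p0 andbT leNgt; apply/negP => p1.
have gB : \int[P]_(w in B) lne (r w)%:E < (c * fine (P B))%:E.
  rewrite -gE//; apply: (@le_lt_trans _ _ (a%:E * P B)).
    apply: ae_integral_le_cst => //; last by apply: aeW => w [].
    exact: measurable_funTS (measurable_wrt_measurable mg).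
  by rewrite -[in X in X < _](fineK Pf) -EFinM lte_fin ltr_pM2r// fine_gt0// p1 ltey_eq Pf.
have irB : P.-integrable B (fun w => (r w)%:E) by exact: integrableS ir.
have [e /andP[e0 e1] eB'] := integral_powR_lt mr r0 mB Pf irB gB.
have eB b : (0 < b <= e)%R -> \int[P]_(w in B) (r w `^ b)%:E <
  P B + (b * (c * fine (P B)))%:E by exact: eB'.
have [q /andP[q0 qe]] : exists q : rat, (0%R : R)%:E < (ratr q)%:E < e%:E.
  by apply: lte_rat_between; rewrite lte_fin.
rewrite lte_fin ltr0q in q0; rewrite lte_fin in qe.
have q1 : (q <= 1)%R by rewrite -(ler_rat R) rmorph1 (le_trans (ltW qe)).
have q01 : (0 < q <= 1)%R by rewrite q0.
have := eB (ratr q); rewrite ltr0q q0 (ltW qe) => /(_ isT).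
apply/negP; rewrite -leNgt -ZE ?ratr01//.
apply: (@le_trans _ _ ((1 + ratr q * c)%:E * P B)).
  by rewrite -[in leRHS](fineK Pf) -[in leLHS](fineK Pf) -EFinM -EFinD lee_fin; lra.
apply: ae_cst_le_integral => //.
  exact: measurable_funTS (measurable_wrt_measurable (mZ (ratr01 q01))).
apply: aeW => w [_ cl _]; apply: (@le_trans _ _ (expR (ratr q * c))%:E).
  by rewrite lee_fin expR_ge1Dx.
have : c%:E <= ((ratr q)^-1)%:E * lne (Z (ratr q) w).
  apply: le_trans cl _; rewrite leeNl; apply: ereal_sup_ubound.
  by exists q.
rewrite lee_pdivlMl ?ltr0q// -EFinM => cZ.
by rewrite -lee_expR_lne.
Qed.

Lemma rate_limitE : exists N, [/\ F t N, P N = 0 &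
  forall w, ~ N w -> lambda w = - g w].
Proof.
have [N [FN N0 Ng]] := slope_lower.
have upper (q : rat) : exists M, [/\ F t M, P M = 0 & (0 < q <= 1)%R ->
    forall w, ~ M w -> g w <= (((ratr q)^-1)%R)%:E * lne (Z (ratr q) w)].
  have [q01|nq] := boolP (0 < q <= 1)%R; last first.
    exists set0; split; [|exact: measure0|by []].
    by rewrite -stage_measurableE; exact: measurable0.
  by have [M [FM M0 Mg]] := jensen_upper (ratr01 q01); exists M; split.
have [M MP] := choice upper.
exists (N `|` \bigcup_q M q); split.
- rewrite -stage_measurableE; apply: measurableU.
    by rewrite stage_measurableE.
  by apply: bigcupT_measurable_rat => q; have [FM _ _] := MP q; rewrite stage_measurableE.
- apply/negligibleP.
    apply: measurableU; first exact: stage_measurable FN.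
    by apply: bigcupT_measurable_rat => q; have [FM _ _] := MP q; exact: stage_measurable FM.
  apply: negligibleU; first by apply/negligibleP => //; exact: stage_measurable FN.
  apply: negligible_bigcup_rat => q; have [FM M0 _] := MP q.
  by apply/negligibleP => //; exact: stage_measurable FM.
move=> w /not_orP[/Ng Nw Mw]; apply/eqP; rewrite eq_le; apply/andP; split.
  apply: ge_ereal_sup => _ [q q01 <-]; rewrite leeN2.
  have [_ _ /(_ q01)] := MP q; apply => Mqw; apply: Mw; by exists q.
by rewrite leeNl.
Qed.

End log_identity.

(** * Likelihood ratios *)

Section density_version.
Context d (T : measurableType d) (R : realType).
Variables P Q : probability T R.
Hypothesis QP : Q `<< P.

(* [density] is a Radon-Nikodym derivative, which may be negative on a null
   set; its absolute value is a real-valued nonnegative version. *)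
Definition rdensity (w : T) : R := `|fine (density Q P w)|%R.

Lemma density_fin_num w : density Q P w \is a fin_num.
Proof. by rewrite /density; apply: Radon_Nikodym_fin_num; exact: QP. Qed.

Lemma measurable_density : measurable_fun setT (density Q P).
Proof.
rewrite /density; apply: (measurable_int P).
by apply: Radon_Nikodym_integrable; exact: QP.
Qed.

Lemma rdensity_ge0 w : (0 <= rdensity w)%R. Proof. exact: normr_ge0. Qed.

Lemma measurable_rdensity : measurable_fun setT rdensity.
Proof.
apply: (measurableT_comp (@normr_measurable R setT)).
by apply: measurableT_comp => //; exact: measurable_density.
Qed.

(** The derivative agrees almost everywhere with that of the sigma-finite construction, which is
    nonnegative. *)
Lemma density_ae_eq : {ae P, forall w, density Q P w = (rdensity w)%:E}.
Proof.
have := ae_eq_Radon_Nikodym_SigmaFinite QP measurableT.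
apply: filterS => w /(_ I) fw.
rewrite /rdensity -abse_EFin fineK ?density_fin_num//.
have -> : density Q P w = Radon_Nikodym_SigmaFinite.f Q P w by rewrite fw.
by rewrite gee0_abs//; exact: (Radon_Nikodym_SigmaFinite.f_ge0 QP).
Qed.

Lemma rdensity_integral A : measurable A ->
  Q A = \int[P]_(w in A) (rdensity w)%:E.
Proof.
move=> mA; transitivity (\int[P]_(w in A) density Q P w).
  by rewrite /density -Radon_Nikodym_integral//; exact: QP.
apply: ae_eq_integral => //.
- exact: measurable_funTS measurable_density.
- by apply: measurable_funTS; apply/measurable_EFinP; exact: measurable_rdensity.
by apply: filterS density_ae_eq => w dw _.
Qed.

Lemma rdensity_integrable : P.-integrable setT (fun w => (rdensity w)%:E).
Proof.
apply: ge0_fin_integrable => //.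
- by apply/measurable_EFinP; exact: measurable_rdensity.
- by move=> w _; rewrite lee_fin rdensity_ge0.
by rewrite -rdensity_integral// probability_setT ltry.
Qed.

Lemma rdensity_change_of_measure (f : T -> \bar R) : measurable_fun setT f ->
  (forall w, 0 <= f w) -> \int[Q]_w f w = \int[P]_w (f w * (rdensity w)%:E).
Proof.
move=> mf f0.
have QE (B : set T) : measurable B ->
    \int[Q]_(w in id @^-1` B) cst 1 w = \int[P]_(w in id @^-1` B) (rdensity w)%:E.
  by move=> mB; rewrite integral_cst// mul1e; exact: rdensity_integral.
transitivity (\int[Q]_w (f w * cst 1 w)).
  by apply: eq_integral => w _; rewrite /= mule1.
have mr : measurable_fun setT (fun w => (rdensity w)%:E).
  by apply/measurable_EFinP; exact: measurable_rdensity.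
have r0 w : 0 <= (rdensity w)%:E by rewrite lee_fin rdensity_ge0.
apply/eqP; rewrite eq_le; apply/andP; split.
- by apply: (@le_integral_weight _ _ _ _ _ T R Q P id id) => // B mB; rewrite QE.
- by apply: (@le_integral_weight _ _ _ _ _ T R P Q id id) => // B mB; rewrite QE.
Qed.

End density_version.

Section likelihood.
Context d (T : measurableType d) (R : realType) (F : filtration T).
Variables P0 P1 : probability T R.
Hypothesis ac : forall t, restr F t P1 `<< restr F t P0.

Local Notation lik := (lik F P0 P1).
Local Notation lik_ratio := (lik_ratio F P0 P1).

Let lik_fin t w : lik t w \is a fin_num.
Proof. exact: (density_fin_num (@ac t)). Qed.

Let measurable_fine_lik t :
  measurable_fun setT (fun w : g_sigma_algebraType (F t) => fine (lik t w)).
Proof.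
by apply: measurableT_comp => //; exact: (measurable_density (@ac t)).
Qed.

Definition rlik t : T -> R := rdensity (restr F t P0) (restr F t P1).

Lemma rlik_ge0 t w : (0 <= rlik t w)%R. Proof. exact: rdensity_ge0. Qed.

Lemma measurable_rlik t :
  measurable_fun setT (rlik t : g_sigma_algebraType (F t) -> R).
Proof. exact: (measurable_rdensity (@ac t)). Qed.

Lemma lik_eq_rlik t : exists N, [/\ F t N, P0 N = 0 &
  forall w, ~ N w -> lik t w = (rlik t w)%:E].
Proof.
have [N [mN N0 Nlik]] := density_ae_eq (@ac t).
exists N; split; [by move: mN; rewrite stage_measurableE|exact: N0|].
by move=> w Nw; apply: contrapT => h; apply: Nw; exact: Nlik.
Qed.

Lemma stage_integral t A (f : T -> \bar R) : F t A -> measurable_wrt (F t) f ->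
    (forall w, 0 <= f w) ->
  \int[restr F t P0]_(w in A) f w = \int[P0]_(w in A) f w.
Proof.
move=> FA mf f0.
have mA : measurable (A : set (g_sigma_algebraType (F t))).
  by rewrite stage_measurableE.
rewrite (ge0_integral_pushforward (@measurable_to_stage _ _ F t))//.
exact: measurable_funTS mf.
Qed.

Lemma lik_integral t A : F t A -> P1 A = \int[P0]_(w in A) (rlik t w)%:E.
Proof.
move=> FA.
have mA : measurable (A : set (g_sigma_algebraType (F t))).
  by rewrite stage_measurableE.
rewrite -(@stage_integral t)//.
- exact: (rdensity_integral (@ac t) mA).
- by apply/measurable_EFinP; exact: measurable_rlik.
- by move=> w; rewrite lee_fin rlik_ge0.
Qed.

Lemma null_transfer t N : F t N -> P0 N = 0 -> P1 N = 0.
Proof.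
move=> FN N0; have /null_content_dominatesP := @ac t; apply => //.
by rewrite stage_measurableE.
Qed.

(** A version of [R_(t+1)], that is, of [lik_ratio t.+1]: the index is that of the denominator. *)
Definition rratio t w : R :=
  (if (0 < rlik t w)%R then rlik t.+1 w / rlik t w else 1)%R.

Lemma rratio_ge0 t w : (0 <= rratio t w)%R.
Proof. by rewrite /rratio; case: ifPn => // _; rewrite divr_ge0// rlik_ge0. Qed.

Lemma measurable_rratio t :
  measurable_fun setT (rratio t : g_sigma_algebraType (F t.+1) -> R).
Proof.
apply: measurable_ratio; first exact: measurable_rlik.
exact: stage_measurable_mono (@measurable_rlik t).
Qed.

Lemma rlik_rratio t w : (0 < rlik t w)%R ->
  rlik t.+1 w = (rlik t w * rratio t w)%R.
Proof. by rewrite /rratio => l0; rewrite l0 mulrC divfK// gt_eqF. Qed.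

Lemma lik_ratioE t w : lik_ratio t.+1 w =
  ((if 0 < fine (lik t w) then fine (lik t.+1 w) / fine (lik t w) else 1)%R)%:E.
Proof.
rewrite /Defs.lik_ratio /= -(fineK (lik_fin t w)) -(fineK (lik_fin t.+1 w)) lte_fin /=.
by case: ifPn => // l0; rewrite inver gt_eqF.
Qed.

Lemma measurable_lik_ratio t : measurable_wrt (F t.+1) (lik_ratio t.+1).
Proof.
rewrite /measurable_wrt (_ : lik_ratio t.+1 = fun w => ((if 0 < fine (lik t w)
  then fine (lik t.+1 w) / fine (lik t w) else 1)%R)%:E); last first.
  by apply/funext => w; exact: lik_ratioE.
apply/measurable_EFinP; apply: measurable_ratio; first exact: measurable_fine_lik.
exact: stage_measurable_mono (@measurable_fine_lik t).
Qed.

Lemma lik_ratio_rratio t :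
  {ae P0, forall w, lik_ratio t.+1 w = (rratio t w)%:E}.
Proof.
have [N [FN N0 NE]] := lik_eq_rlik t; have [M [FM M0 ME]] := lik_eq_rlik t.+1.
exists (N `|` M); split.
- by apply: measurableU; [exact: stage_measurable FN|exact: stage_measurable FM].
- by apply: null_set_setU => //; [exact: stage_measurable FN|exact: stage_measurable FM].
move=> w /= h; apply: contrapT => /not_orP[Nw Mw]; apply: h.
by rewrite lik_ratioE NE// ME.
Qed.

End likelihood.

(** * Change of measure and conditional moments of the likelihood ratio *)

Section growth_bound.
Context d (T : measurableType d) (R : realType) (F : filtration T).
Variables P0 P1 : probability T R.
Hypothesis ac : forall t, restr F t P1 `<< restr F t P0.

Local Notation rlik := (rlik F P0 P1).
Local Notation rratio := (rratio F P0 P1).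
Local Notation lik_ratio := (lik_ratio F P0 P1).

Lemma measurable_rlikT t : measurable_fun setT (fun w => (rlik t w)%:E).
Proof.
apply: (@measurable_wrt_measurable _ _ _ F t); apply/measurable_EFinP.
exact: measurable_rlik.
Qed.

Lemma measurable_rratioT t : measurable_fun setT (rratio t).
Proof.
apply/measurable_EFinP; apply: (@measurable_wrt_measurable _ _ _ F t.+1).
by apply/measurable_EFinP; exact: measurable_rratio.
Qed.

Let mrlik := @measurable_rlikT.
Let mrratio := @measurable_rratioT.

Let rlik0 t w : 0 <= (rlik t w)%:E. Proof. by rewrite lee_fin rlik_ge0. Qed.

Lemma change_of_measure t (f : T -> \bar R) : measurable_wrt (F t) f ->
  (forall w, 0 <= f w) -> \int[P1]_w f w = \int[P0]_w (f w * (rlik t w)%:E).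
Proof.
move=> mf f0.
have mT := @measurable_to_stage _ _ F t.
have PE (B : set (g_sigma_algebraType (F t))) : measurable B ->
    \int[P1]_(w in @to_stage _ _ F t @^-1` B) cst 1 w =
    \int[P0]_(w in @to_stage _ _ F t @^-1` B) (rlik t w)%:E.
  rewrite stage_measurableE => FB.
  rewrite integral_cst ?mul1e; last exact: stage_measurable FB.
  exact: lik_integral.
transitivity (\int[P1]_w (f w * cst 1 w)).
  by apply: eq_integral => w _; rewrite /= mule1.
apply/eqP; rewrite eq_le; apply/andP; split.
- by apply: (le_integral_weight mT mT) => // B mB; rewrite PE.
- by apply: (le_integral_weight mT mT) => // B mB; rewrite PE.
Qed.

(** Both sides are the [P1]-integral of [f]. *)
Lemma rlik_martingale t (f : T -> \bar R) : measurable_wrt (F t) f ->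
    (forall w, 0 <= f w) ->
  \int[P0]_w (f w * (rlik t.+1 w)%:E) = \int[P0]_w (f w * (rlik t w)%:E).
Proof.
move=> mf f0; rewrite -!change_of_measure//.
exact: (stage_measurable_mono (leqnSn t) mf).
Qed.

Lemma stage_rlik_gt0 t : F t [set w | (0 < rlik t w)%R].
Proof.
rewrite -stage_measurableE.
rewrite (_ : [set w | _] = setT `&` (fun w => 0 < rlik t w)%R @^-1` [set true]).
  by apply: measurable_fun_ltr => //; exact: measurable_rlik.
by rewrite setTI; apply/seteqP; split => w /=.
Qed.

(** On the set [D] where [L_t > 0] the ratio is [L_(t+1) / L_t], and the martingale property
    replaces [L_(t+1)] by [L_t]; off [D] the ratio is 1. *)
Lemma rratio_integral t A : F t A -> \int[P0]_(w in A) (rratio t w)%:E <= P0 A.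
Proof.
move=> FA; have mA := stage_measurable FA.
pose D := [set w | (0 < rlik t w)%R]; have FD : F t D by exact: stage_rlik_gt0.
have FDC : F t (A `\` D).
  by rewrite -stage_measurableE; apply: measurableD; rewrite stage_measurableE.
(* [h] is [1 / L_t] on the part of [A] in [D] and 0 elsewhere; the value 1 of the second branch is
   cancelled by the indicator. *)
pose h w := (\1_(A `&` D) w * (if 0 < rlik t w then 1 / rlik t w else 1))%R.
have mh : measurable_wrt (F t) (fun w => (h w)%:E).
  apply/measurable_EFinP; apply: measurable_funM.
    by apply: measurable_indic; rewrite stage_measurableE; exact: stage_setI.
  by apply: measurable_ratio => //; exact: measurable_rlik.
have h0 w : 0 <= (h w)%:E.
  by rewrite lee_fin mulr_ge0//; case: ifPn => // l0; rewrite divr_ge0// ltW.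
have mhT := measurable_wrt_measurable mh.
have m1 : measurable_fun setT (fun w => (\1_(A `\` D) w)%:E : \bar R).
  by apply/measurable_EFinP; apply: measurable_indic; exact: stage_measurable FDC.
rewrite integral_mkcond -[leRHS]mul1e -integral_cst// [leRHS]integral_mkcond.
rewrite (eq_integral (fun w => (h w)%:E * (rlik t.+1 w)%:E + (\1_(A `\` D) w)%:E)).
  rewrite ge0_integralD//; [|by move=> w _; exact: mule_ge0|exact: emeasurable_funM].
  rewrite rlik_martingale// -ge0_integralD//;
    [|by move=> w _; exact: mule_ge0|exact: emeasurable_funM].
  rewrite le_eqVlt; apply/orP; left; apply/eqP.
  apply: eq_integral => w _; rewrite /patch /h !indicE in_setI in_setD.
  case: (w \in A) => /=; last by rewrite !mul0r mul0e adde0.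
  have [wD|wD] := boolP (w \in D).
    by move: (wD); rewrite inE /D/= => l0; rewrite l0 mul1r adde0 -EFinM mul1r mulVf ?gt_eqF.
  by rewrite mul0r mul0e add0e.
move=> w _; rewrite /patch /h !indicE in_setI in_setD.
case: (w \in A) => /=; last by rewrite !mul0r mul0e adde0.
have [wD|wD] := boolP (w \in D).
  by move: (wD); rewrite inE /D/= /rratio => l0; rewrite l0 mul1r adde0 -EFinM mul1r mulrC.
by move: (wD); rewrite notin_setE /D/= /rratio => /negP/negbTE ->; rewrite mul0r mul0e add0e.
Qed.

Lemma rratio_integrable t : P0.-integrable setT (fun w => (rratio t w)%:E).
Proof.
apply: ge0_fin_integrable => //; first by apply/measurable_EFinP.
  by move=> w _; rewrite lee_fin rratio_ge0.
apply: le_lt_trans (rratio_integral _) _.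
  by rewrite -stage_measurableE; exact: measurableT.
by rewrite probability_setT ltry.
Qed.

Let lne_ratio_rratio t :
  {ae P0, forall w, lne (lik_ratio t.+1 w) = lne (rratio t w)%:E}.
Proof. by apply: filterS (lik_ratio_rratio ac t) => w ->. Qed.

Let measurable_lik_ratioT t : measurable_fun setT (lik_ratio t.+1).
Proof.
by apply: (@measurable_wrt_measurable _ _ _ F t.+1); exact: measurable_lik_ratio.
Qed.

Let measurable_lne_lik_ratio t :
  measurable_fun setT (fun w => lne (lik_ratio t.+1 w)).
Proof. exact: (measurableT_comp (@emeasurable_lne R) (@measurable_lik_ratioT t)). Qed.

Let measurable_lne_rratio t : measurable_fun setT (fun w => lne (rratio t w)%:E).
Proof. by apply: measurable_lne_comp. Qed.

(** Since [log R <= R], the positive part has a finite integral, so the conditional expectation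
    exists even if [log R] has integral [-oo]. *)
Lemma log_lik_ratio_condexp t :
  let g := condexp P0 (F t) (fun w => lne (lik_ratio t.+1 w)) in
  measurable_wrt (F t) g /\
  forall A, F t A ->
    \int[P0]_(w in A) g w = \int[P0]_(w in A) lne (rratio t w)%:E.
Proof.
move=> g.
have [||_ _ mg gE] := @quasi_is_condexp _ _ _ F P0 t (fun w => lne (lik_ratio t.+1 w)).
- exact: measurable_lne_lik_ratio.
- apply: (@le_lt_trans _ _ (\int[P0]_w (rratio t w)%:E)).
    apply: ae_ge0_le_integral => //.
    + by apply: measurable_funepos; exact: measurable_lne_lik_ratio.
    + by move=> w _; rewrite lee_fin rratio_ge0.
    + by apply/measurable_EFinP.
    apply: filterS (@lne_ratio_rratio t) => w E _; rewrite funeposE E ge_max.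
    by rewrite lee_fin rratio_ge0 andbT; apply/ltW/lne_sublinear.
  exact: integrable_lty (rratio_integrable t).
split => // A FA; rewrite gE//; have mA := stage_measurable FA.
apply: ae_eq_integral => //.
- exact: measurable_funTS.
- exact: measurable_funTS.
by apply: filterS (@lne_ratio_rratio t) => w E _.
Qed.

Lemma hellinger_condexp t b :
  measurable_wrt (F t) (hellinger F P0 P1 b t.+1) /\
  forall A, F t A -> \int[P0]_(w in A) hellinger F P0 P1 b t.+1 w =
    \int[P0]_(w in A) (rratio t w `^ b)%:E.
Proof.
have [||_ _ mg gE] := @ge0_is_condexp _ _ _ F P0 t (fun w => lik_ratio t.+1 w `^ b).
- exact: (measurableT_comp (@measurable_poweR R b) (@measurable_lik_ratioT t)).
- by move=> w; exact: poweR_ge0.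
split => // A FA; rewrite [LHS]gE//; have mA := stage_measurable FA.
apply: ae_eq_integral => //.
- apply: measurable_funTS.
  exact: (measurableT_comp (@measurable_poweR R b) (@measurable_lik_ratioT t)).
- apply/measurable_EFinP; exact: measurable_powR_comp.
by apply: filterS (lik_ratio_rratio ac t) => w -> _.
Qed.

Lemma measurable_lam0 t : measurable_wrt (F t) (lam0 F P0 P1 t.+1).
Proof.
by apply: (@measurable_rate _ _ _ F t (fun b => hellinger F P0 P1 b t.+1)) => b _;
  have [] := hellinger_condexp t b.
Qed.

Lemma lam0E t : exists N, [/\ F t N, P0 N = 0 & forall w, ~ N w ->
  lam0 F P0 P1 t.+1 w =
  - condexp P0 (F t) (fun w' => lne (lik_ratio t.+1 w')) w].
Proof.
have [mg gE] := log_lik_ratio_condexp t.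
apply: (@rate_limitE _ _ _ F t P0 (rratio t) _ _ _
  (fun b => hellinger F P0 P1 b t.+1)) => //.
- exact: rratio_ge0.
- exact: rratio_integrable.
- by move=> b _; have [] := hellinger_condexp t b.
- by move=> b A _; have [_] := hellinger_condexp t b; exact.
Qed.

End growth_bound.

(** If one factor is 0 and the other [+oo], the left side is 0 and the right side [+oo]. The
    inequality has the direction required by a lower bound on inverse moments of wealth. *)
Lemma le_invepM (R : realType) (x y : \bar R) : 0 <= x -> 0 <= y ->
  x^-1 * y^-1 <= (x * y)^-1.
Proof.
move=> x0 y0; have [->|xn0] := eqVneq x 0; first by rewrite mul0e inve0 leey.
have [->|yn0] := eqVneq y 0; first by rewrite mule0 inve0 leey.
rewrite inveM//; move: x0 y0 xn0 yn0.
case: x => [x| |]//; case: y => [y| |]//; rewrite ?lee_fin /inveM_def ?eqe.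
- by move=> _ _ /negbTE -> /negbTE ->.
- by move=> x0 _ xn0 _; rewrite lt_neqAle eq_sym xn0.
- by move=> _ y0 _ yn0; rewrite lt_neqAle eq_sym yn0.
Qed.

(** * One step of the wealth process *)

Section wealth_growth.
Context d (T : measurableType d) (R : realType) (F : filtration T).
Variables P0 P1 : probability T R.
Hypothesis ac : forall t, restr F t P1 `<< restr F t P0.

Local Notation rlik := (rlik F P0 P1).
Local Notation rratio := (rratio F P0 P1).
Local Notation lam0 := (lam0 F P0 P1).

(** Jensen's inequality at [b = 1], [c = 0], because the ratio has conditional mean at most 1. *)
Lemma lam0_ge0 t : exists N, [/\ F t N, P0 N = 0 &
  forall w, ~ N w -> 0 <= lam0 t.+1 w].
Proof.
have [mg gE] := log_lik_ratio_condexp ac t.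
have [N [FN N0 NE]] := lam0E ac t.
set g := condexp _ _ _ in mg gE NE.
have [A FA _|M [FM M0 ME]] := @stage_ae_le_integral _ _ _ F P0 t setT g (cst 0)
    (stage_setT F t) mg (measurable_cst _).
  have mA := stage_measurable FA.
  have rA : \int[P0]_(w in A) (rratio t w `^ 1)%:E <= (expR 0)%:E * P0 A.
    rewrite expR0 mul1e; under eq_integral do rewrite powRr1 ?rratio_ge0//.
    exact: rratio_integral.
  have := integral_lne_le (@measurable_rratioT _ _ _ F P0 P1 ac t)
    (rratio_ge0 F P0 P1 t) mA (fin_num_measure P0 _ mA) ltr01 rA.
  by rewrite mul0r mul0e integral0 gE.
exists (N `|` M); split.
- by rewrite -stage_measurableE; apply: measurableU; rewrite stage_measurableE.
- by apply: null_set_setU => //; [exact: stage_measurable FN|exact: stage_measurable FM].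
by move=> w /not_orP[Nw Mw]; rewrite NE// leeNr oppe0; exact: ME.
Qed.

(* The tangent inequality is integrated over the F_t-sets where L_t > 0, on
   which P1-almost sure bounds on the F_t-measurable lam0 hold P0-almost
   surely. *)
Lemma wealth_step_ge t l s (E V : T -> \bar R) : (0 <= s)%R ->
    ess_sup P1 (lam0 t.+1) <= l%:E ->
    measurable_wrt (F t.+1) E -> (forall w, 0 <= E w) ->
    {ae P0, forall w, condexp P0 (F t) E w <= 1} ->
    measurable_wrt (F t) V -> (forall w, 0 <= V w) ->
  (expR (- l))%:E * \int[P1]_w V w <= \int[P1]_w (V w * (E w `^ s)^-1).
Proof.
move=> s0 lamE mE E0 EP mV V0.
have mET := measurable_wrt_measurable mE.
have [mg gE] := log_lik_ratio_condexp ac t.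
have [N [FN N0 NE]] := lam0E ac t.
set g := condexp _ _ _ in mg gE NE.
have [_ _ mc cE] := ge0_is_condexp F P0 t mET E0.
have EB B : F t B -> \int[P0]_(w in B) E w <= P0 B.
  move=> FB; have mB := stage_measurable FB.
  rewrite -cE// -[leRHS]mul1e -integral_cst//; apply: ae_le_integral => //.
    exact: measurable_funTS (measurable_wrt_measurable mc).
  by apply: filterS EP => w Ew _.
pose D := [set w | (0 < rlik t w)%R].
have FD : F t D by exact: stage_rlik_gt0.
pose M := D `&` [set w | l%:E < lam0 t.+1 w].
have FM : F t M.
  apply: stage_setI => //; rewrite -stage_measurableE -[X in measurable X]setTI.
  by apply: measurable_lte => //; exact: measurable_lam0.
have mM := stage_measurable FM.
have M0 : P0 M = 0.
  have PM0 : P1 M = 0.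
    apply/negligibleP => //; have /ess_supP := lamE.
    by apply: negligibleS => w [_ /=]; rewrite ltNge => /negP.
  have : \int[P0]_(w in M) `|(rlik t w)%:E| = 0.
    rewrite -PM0 (lik_integral ac FM); apply: eq_integral => w _.
    by rewrite gee0_abs// lee_fin rlik_ge0.
  move/ae_eq_integral_abs => /(_ mM (measurable_funTS (@measurable_rlikT _ _ _ F P0 P1 ac t))).
  move=> /negligibleS M0; apply/negligibleP => //; apply: M0 => w Mw /= /(_ Mw) lw0.
  by have [] := Mw; rewrite /D/= -lte_fin lw0 ltxx.
have key B : F t B -> B `<=` D -> (expR (- l))%:E * P0 B <=
    \int[P0]_(w in B) ((E w `^ s)^-1 * (rratio t w)%:E).
  move=> FB BD; have mB := stage_measurable FB.
  apply: integral_wealth_ge => //.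
  - exact: measurable_rratioT.
  - exact: rratio_ge0.
  - exact: fin_num_measure.
  - exact: integrableS (rratio_integrable ac t).
  - exact: EB.
  rewrite -gE// -mulNe -EFinN; apply: ae_cst_le_integral => //.
    exact: measurable_funTS (measurable_wrt_measurable mg).
  exists (N `|` M); split.
  - by apply: measurableU => //; exact: stage_measurable FN.
  - by apply: null_set_setU => //; exact: stage_measurable FN.
  move=> w /= h; apply: contrapT => /not_orP[Nw Mw]; apply: h => Bw.
  rewrite EFinN leeNl -NE// leNgt; apply/negP => lw; apply: Mw.
  by split => //; exact: BD.
have mD := stage_measurable FD.
have mTS := @measurable_to_stage _ _ F t.
(* Extending both sides of [key] by 0 off [D] makes the inequality hold over every set of [F t]. *)
pose u := (cst (expR (- l))%:E : T -> \bar R) \_ D.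
pose v := (fun w => (E w `^ s)^-1 * (rratio t w)%:E) \_ D.
have mEs := measurable_poweR_inv s mET E0.
have mv : measurable_fun setT v.
  apply/(measurable_restrictT _ mD); apply: measurable_funTS.
  by apply: emeasurable_funM => //; apply/measurable_EFinP; exact: measurable_rratioT.
have mu : measurable_fun setT u.
  by apply/(measurable_restrictT _ mD); exact: measurable_cst.
have u0 w : 0 <= u w.
  by rewrite /u /patch; case: ifP => // _; rewrite lee_fin expR_ge0.
have v0 w : 0 <= v w.
  rewrite /v /patch; case: ifP => // _.
  by rewrite mule_ge0// ?poweR_inv_ge0// lee_fin rratio_ge0.
have mVlk : measurable_wrt (F t) (fun w => V w * (rlik t w)%:E).
  apply: emeasurable_funM => //; apply/measurable_EFinP; exact: measurable_rlik.
have Vlk0 w : 0 <= V w * (rlik t w)%:E by rewrite mule_ge0// lee_fin rlik_ge0.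
have uv (B : set (g_sigma_algebraType (F t))) : measurable B ->
    \int[P0]_(w in @to_stage _ _ F t @^-1` B) u w <=
    \int[P0]_(w in @to_stage _ _ F t @^-1` B) v w.
  rewrite stage_measurableE => FB; rewrite /u /v -!integral_mkcondr.
  have FBD : F t (B `&` D) by exact: stage_setI.
  rewrite integral_cst; last exact: stage_measurable FBD.
  by apply: key => // w [].
(* The weight [V L_t] turns the [P0]-integral on the left into [exp (- l)] times the [P1]-integral
   of [V], because [L_t = 0] off [D]. *)
have := le_integral_weight mTS mTS mu mv u0 v0 uv mVlk Vlk0.
rewrite (eq_integral (fun w => (expR (- l))%:E * (V w * (rlik t w)%:E))).
  rewrite ge0_integralZl//; last exact: (@measurable_wrt_measurable _ _ _ F t).
  rewrite -change_of_measure// => /le_trans; apply.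
  have mVT := measurable_wrt_measurable mV.
  have mVE : measurable_wrt (F t.+1) (fun w => V w * (E w `^ s)^-1).
    apply: emeasurable_funM; first exact: (stage_measurable_mono (leqnSn t) mV).
    exact: (@measurable_poweR_inv _ (g_sigma_algebraType (F t.+1))).
  rewrite (change_of_measure ac mVE); last first.
    by move=> w; rewrite mule_ge0// poweR_inv_ge0.
  apply: ge0_le_integral => //.
  - by move=> w _; rewrite mule_ge0.
  - by apply: emeasurable_funM => //; exact: (@measurable_wrt_measurable _ _ _ F t).
  - by apply: emeasurable_funM; [exact: emeasurable_funM|exact: measurable_rlikT].
  (* On [D], [L_t R_(t+1) = L_(t+1)]; off [D] the left side is 0. *)
  move=> w _; rewrite /v /patch; case: ifPn => [|_]; last first.
    by rewrite mule0 !mule_ge0// ?poweR_inv_ge0// lee_fin rlik_ge0.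
  rewrite inE /D/= => lw0; rewrite (rlik_rratio lw0) EFinM.
  by rewrite -!muleA lee_wpmul2l// muleCA.
move=> w _; rewrite /u /patch; case: ifPn => [_|]; first by rewrite muleC.
rewrite notin_setE /D/= => /negP; rewrite -leNgt => lw.
have -> : rlik t w = 0%R by apply/eqP; rewrite eq_le lw rlik_ge0.
by rewrite !mule0.
Qed.

End wealth_growth.

(** * Growth bound by induction on time *)

Section growth_theorem.
Context d (T : measurableType d) (R : realType) (F : filtration T).
Variables P0 P1 : probability T R.
Hypothesis ac : forall t, restr F t P1 `<< restr F t P0.

Lemma ae_transfer t N (Q : T -> Prop) : F t N -> P0 N = 0 ->
    (forall w, ~ N w -> Q w) ->
  {ae P0, forall w, Q w} /\ {ae P1, forall w, Q w}.
Proof.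
move=> FN N0 NQ; have mN := stage_measurable FN.
split; exists N; split => //; try exact: (null_transfer ac FN N0).
- by move=> w /= nQ; apply: contrapT => /NQ.
- by move=> w /= nQ; apply: contrapT => /NQ.
Qed.

Lemma ess_sup_lam0_ge0 t : 0 <= ess_sup P1 (lam0 F P0 P1 t.+1).
Proof.
have [N [FN N0 NE]] := lam0_ge0 ac t.
apply: ess_sup_gee; first by rewrite [X in _ < X]probability_setT lte01.
by have [] := ae_transfer FN N0 NE.
Qed.

Lemma lam0_meanE t : lam0_mean F P0 P1 t =
  (t%:R^-1)%:E * \sum_(i < t) ess_sup P1 (lam0 F P0 P1 i.+1).
Proof. by rewrite /lam0_mean big_add1 big_mkord. Qed.

Section wealth_process.
Variable E : nat -> T -> \bar R.
Hypothesis bE : betting F P0 E.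

Lemma wealthS t w : wealth E t.+1 w = wealth E t w * E t.+1 w.
Proof. by rewrite /wealth big_nat_recr. Qed.

Lemma measurable_wealth t : measurable_wrt (F t) (wealth E t).
Proof.
elim: t => [|t IH].
  rewrite /measurable_wrt (_ : wealth E 0 = cst 1); first exact: measurable_cst.
  by apply/funext => w; rewrite /wealth big_geq.
rewrite /measurable_wrt (_ : wealth E t.+1 = fun w => wealth E t w * E t.+1 w).
  apply: emeasurable_funM; first exact: (stage_measurable_mono (leqnSn t) IH).
  by have [] := bE (ltn0Sn t).
by apply/funext => w; rewrite wealthS.
Qed.

Lemma wealth_ge0 t w : 0 <= wealth E t w.
Proof.
elim: t => [|t IH]; first by rewrite /wealth big_geq.
by rewrite wealthS mule_ge0//; have [_ + _] := bE (ltn0Sn t); exact.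
Qed.

Lemma wealth_moment_ge (l : nat -> R) s t : (0 <= s)%R ->
    (forall n, (n < t)%N -> ess_sup P1 (lam0 F P0 P1 n.+1) <= (l n)%:E) ->
  (expR (- \sum_(n < t) l n))%:E <= \int[P1]_w (wealth E t w `^ s)^-1.
Proof.
move=> s0; elim: t => [_|t IH lamE].
  rewrite big_ord0 oppr0 expR0 (eq_integral (cst 1)); last first.
    by move=> w _; rewrite /wealth big_geq// poweR1r inve1.
  by rewrite integral_cst// mul1e [leRHS]probability_setT.
have [mE E0 E1] := bE (ltn0Sn t).
rewrite big_ord_recr /= opprD expRD EFinM muleC.
apply: (@le_trans _ _ (\int[P1]_w ((wealth E t w `^ s)^-1 * (E t.+1 w `^ s)^-1))).
  apply: (@le_trans _ _ ((expR (- l t))%:E * \int[P1]_w (wealth E t w `^ s)^-1)).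
    rewrite lee_wpmul2l ?lee_fin ?expR_ge0// IH// => n nt.
    by apply: lamE; exact: ltnW.
  apply: wealth_step_ge => //; first exact: lamE.
  - exact: mE.
  - exact: E1.
  - have mW := @measurable_wealth t; rewrite /measurable_wrt in mW *.
    have W0 := @wealth_ge0 t.
    exact: (@measurable_poweR_inv _ (g_sigma_algebraType (F t))).
  - by move=> w; exact: poweR_inv_ge0.
have mET := measurable_wrt_measurable mE.
have mW := measurable_wrt_measurable (@measurable_wealth t).
have mW1 := measurable_wrt_measurable (@measurable_wealth t.+1).
apply: ge0_le_integral => //.
- by move=> w _; rewrite mule_ge0// poweR_inv_ge0.
- by apply: emeasurable_funM; apply: measurable_poweR_inv => //; exact: wealth_ge0.
- by apply: measurable_poweR_inv => //; exact: wealth_ge0.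
move=> w _; rewrite wealthS poweRM ?wealth_ge0//.
by apply: le_invepM; exact: poweR_ge0.
Qed.

Lemma growth_le_mean s t : (0 < t)%N -> (0 <= s)%R ->
  growth P1 E s t <= lam0_mean F P0 P1 t.
Proof.
move=> t0 s0; rewrite lam0_meanE.
set L := fun n => ess_sup P1 (lam0 F P0 P1 n.+1).
have L0 n : 0 <= L n by exact: ess_sup_lam0_ge0.
have S0 : 0 <= \sum_(i < t) L i by exact: sume_ge0.
have tV0 : (0 < t%:R^-1 :> R)%R by rewrite invr_gt0 ltr0n.
(* If the sum is infinite the bound is trivial; otherwise each term, being nonnegative, is finite
   and serves as a real bound [l n]. *)
have [Sy|Sy] := eqVneq (\sum_(i < t) L i) +oo.
  by rewrite Sy gt0_muley ?leey// lte_fin.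
have Lfin n : (n < t)%N -> L n \is a fin_num.
  move=> nt; rewrite ge0_fin_numE//; apply: (@le_lt_trans _ _ (\sum_(i < t) L i)).
    by rewrite (bigD1 (Ordinal nt))//= leeDl// sume_ge0.
  by rewrite ltey.
have -> : \sum_(i < t) L i = (\sum_(i < t) fine (L i))%:E.
  by rewrite -sumEFin; apply: eq_bigr => i _; rewrite fineK// Lfin.
have : (expR (- \sum_(n < t) fine (L n)))%:E <= \int[P1]_w (wealth E t w `^ s)^-1.
  by apply: (@wealth_moment_ge (fun n => fine (L n))) => // n nt; rewrite fineK// Lfin.
rewrite -lee_expR_lne => Sle.
rewrite /growth -muleN; apply: lee_wpmul2l; first by rewrite lee_fin ltW.
by rewrite leeNl -EFinN.
Qed.

End wealth_process.

End growth_theorem.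

(** * The i.i.d. model *)

Lemma exists_density_measure d (T : measurableType d) (R : realType)
    (mu : {measure set T -> \bar R}) (f : T -> \bar R) :
    measurable_fun setT f -> (forall x, 0 <= f x) ->
  exists m : {measure set T -> \bar R}, forall A, m A = \int[mu]_(x in A) f x.
Proof.
move=> mf f0; pose m0 A := \int[mu]_(x in A) f x.
have m00 : m0 set0 = 0 by rewrite /m0 integral_set0.
have m0_ge0 A : 0 <= m0 A by exact: integral_ge0.
have m0_add : semi_sigma_additive m0 by exact: semi_sigma_additive_nng_induced.
pose m_mixin := isMeasure.Build _ _ _ m0 m00 m0_ge0 m0_add.
by exists (HB.pack_for {measure set T -> \bar R} m0 m_mixin).
Qed.

(** * Rectangles and independence of the next coordinate *)

Section coordinates.
Context d (X : measurableType d) (R : realType).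
Local Notation S := (seq_space X).
Local Notation F := (iid_filtration X).

Lemma coord_sigma_coord n i (B : set X) : (i < n)%N -> measurable B ->
  F n [set w : S | B (w i)].
Proof.
move=> ni mB; apply: sub_sigma_algebra; exists i => //.
by exists B => //; rewrite setTI.
Qed.

Lemma measurable_coord_stage n i : (i < n)%N ->
  measurable_fun setT (fun w : g_sigma_algebraType (F n) => w i).
Proof.
move=> ni _ B mB; rewrite setTI stage_measurableE; exact: coord_sigma_coord.
Qed.

Lemma measurable_coord i : measurable_fun setT (fun w : S => w i).
Proof.
move=> _ B mB; rewrite setTI.
by apply: (@stage_measurable _ _ F i.+1); exact: coord_sigma_coord.
Qed.

Definition rectangle n (A : nat -> set X) : set S :=
  [set w | forall i, (i < n)%N -> A i (w i)].

Lemma rectangleS n A :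
  rectangle n.+1 A = rectangle n A `&` [set w | A n (w n)].
Proof.
apply/seteqP; split => [w wA|w [wA An] i].
  by split => [i ni|]; apply: wA => //; exact: ltnW.
by rewrite ltnS leq_eqVlt => /predU1P[->//|]; exact: wA.
Qed.

Lemma stage_rectangle n A : (forall i, measurable (A i)) -> F n (rectangle n A).
Proof.
move=> mA; elim: n => [|n IH].
  rewrite (_ : rectangle 0 A = setT); first exact: stage_setT.
  by apply/seteqP; split.
rewrite rectangleS; apply: stage_setI; last exact: coord_sigma_coord.
exact: (sigma_at_mono (leqnSn n) IH).
Qed.

(** Rectangles are stable under intersection and generate [F n]: each coordinate set is a rectangle
    with a single nontrivial side. *)
Lemma measure_eq_on_stage n (m1 m2 : {measure set S -> \bar R}) :
    m1 setT < +oo ->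
    (forall A, (forall i, measurable (A i)) ->
      m1 (rectangle n A) = m2 (rectangle n A)) ->
  forall B, F n B -> m1 B = m2 B.
Proof.
move=> m1oo m12 B FB.
pose G := [set rectangle n A | A in
  [set A : nat -> set X | forall i, measurable (A i)]].
have GT : G setT.
  by exists (fun=> setT) => //; apply/seteqP; split.
apply: (g_sigma_algebra_measure_unique G _ (fun=> setT)) => //.
- by move=> _ [A mA <-]; apply: (@stage_measurable _ _ F n); exact: stage_rectangle.
- by rewrite bigcup_const//; exists 0%N.
- move=> _ _ [A mA <-] [A' mA' <-]; exists (fun i => A i `&` A' i).
    by move=> i; exact: measurableI.
  apply/seteqP; split => [w wA|w [wA wA'] i ni].
    by split => i ni; have [] := wA i ni.
  by split; [exact: wA|exact: wA'].
- by move=> _ [A mA <-]; exact: m12.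
suff : @coord_sigma _ X n `<=` <<s G >> by exact.
apply: smallest_sub; first exact: smallest_sigma_algebra.
move=> _ [i /= ni [D mD <-]]; rewrite setTI; apply: sub_sigma_algebra.
exists (fun j => if j == i then D else setT).
  by move=> j; case: ifP.
apply/seteqP; split => [w /(_ i ni)|w Dw j nj]; first by rewrite eqxx.
by case: eqP => // ->.
Qed.

Section independence.
Variables (P : probability X R) (PP : probability S R).
Hypothesis iidP : is_iid_product P PP.

Lemma rectangle_product n A : (forall i, measurable (A i)) ->
  PP (rectangle n A) = \prod_(i < n) P (A i).
Proof. exact: iidP. Qed.

(** Coordinate [n] is the first that [F n] does not see. Both sides are finite measures in [B], and
    they agree on rectangles. *)
Lemma independent_coord n B D : F n B -> measurable D ->
  PP (B `&` [set w | D (w n)]) = PP B * P D.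
Proof.
move=> FB mD.
have mDn : measurable [set w : S | D (w n)].
  by apply: (@stage_measurable _ _ F n.+1); exact: coord_sigma_coord.
have PDfin : P D \is a fin_num by exact: fin_num_measure.
have PD0 : (0 <= fine (P D))%R by rewrite fine_ge0.
pose m1 := mrestr PP mDn; pose m2 := mscale (NngNum PD0) PP.
transitivity (m1 B) => //; transitivity (m2 B); last first.
  by rewrite /m2 /mscale /= fineK// muleC.
apply: (@measure_eq_on_stage n m1 m2) => //.
  apply: (@le_lt_trans _ _ 1); last exact: ltry.
  exact: (probability_le1 PP (measurableI _ _ measurableT mDn)).
move=> A mA; rewrite [RHS](_ : _ = P D * PP (rectangle n A)); last first.
  by rewrite -[in RHS](fineK PDfin).
rewrite [LHS](_ : _ = PP (rectangle n A `&` [set w | D (w n)]))//.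
(* Side [n] becomes [D], so that the intersection is a rectangle with [n.+1] sides. *)
pose A' i := if (i < n)%N then A i else D.
have mA' i : measurable (A' i) by rewrite /A'; case: ifP.
rewrite (_ : _ `&` _ = rectangle n.+1 A'); last first.
  rewrite rectangleS {2}/A' ltnn; congr (_ `&` _).
  by apply/seteqP; split => w wA i ni; move: (wA i ni); rewrite /A' ni.
rewrite !rectangle_product// big_ord_recr /= /A' ltnn muleC.
by congr (_ * _); apply: eq_bigr => i _; rewrite ltn_ord.
Qed.

(** The comparison principle is applied twice: for a fixed [D] it passes from sets of [F n] to [h],
    then from the sets [D] to [f]. *)
Lemma integral_independent_coord n (h : S -> \bar R) (f : X -> \bar R) :
    measurable_wrt (F n) h -> (forall w, 0 <= h w) ->
    measurable_fun setT f -> (forall x, 0 <= f x) ->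
  \int[PP]_w (f (w n) * h w) = \int[P]_x f x * \int[PP]_w h w.
Proof.
move=> mh h0 mf f0.
have mT := @measurable_to_stage _ _ F n.
have mcoord := @measurable_coord n.
have hT := measurable_wrt_measurable mh.
have hD D : measurable D -> \int[PP]_(w in (fun w : S => w n) @^-1` D) h w =
    \int[PP]_w h w * P D.
  move=> mD.
  have mDn : measurable ((fun w : S => w n) @^-1` D).
    by rewrite -[X in measurable X]setTI; exact: mcoord.
  have PD0 : 0 <= P D by exact: measure_ge0.
  rewrite -ge0_integralZr// [LHS]integral_mkcond.
  transitivity (\int[PP]_w (h w * (\1_((fun w : S => w n) @^-1` D) w)%:E)).
    apply: eq_integral => w _; rewrite /patch indicE.
    by case: ifP; rewrite ?mule1 ?mule0.
  have m1 : measurable_fun setT (fun w => (\1_((fun w : S => w n) @^-1` D) w)%:E : \bar R).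
    by apply/measurable_EFinP; exact: measurable_indic.
  have E (B : set (g_sigma_algebraType (F n))) : measurable B ->
      \int[PP]_(w in @to_stage _ _ F n @^-1` B) (\1_((fun w : S => w n) @^-1` D) w)%:E =
      \int[PP]_(w in @to_stage _ _ F n @^-1` B) cst (P D) w.
    rewrite stage_measurableE => FB; have mB := stage_measurable FB.
    rewrite integral_indic// integral_cst// setIC muleC.
    exact: independent_coord.
  apply/eqP; rewrite eq_le; apply/andP; split.
  - by apply: (le_integral_weight mT mT) => // B mB; rewrite E.
  - by apply: (le_integral_weight mT mT) => // B mB; rewrite E.
have H0 : 0 <= \int[PP]_w h w by exact: integral_ge0.
rewrite -ge0_integralZr//.
have hE (B : set X) : measurable B ->
    \int[PP]_(w in (fun w : S => w n) @^-1` B) h w =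
    \int[P]_(x in id @^-1` B) cst (\int[PP]_w h w) x.
  by move=> mB; rewrite hD// integral_cst.
apply/eqP; rewrite eq_le; apply/andP; split.
- apply: (@le_integral_weight _ _ _ S X X R PP P (fun w : S => w n) id) => //.
  by move=> B mB; rewrite hE.
- apply: (@le_integral_weight _ _ _ X S X R P PP id (fun w : S => w n)) => //.
  by move=> B mB; rewrite hE.
Qed.

End independence.

End coordinates.

(** * Product likelihood and constancy of the rates *)

Section iid_rates.
Context d (X : measurableType d) (R : realType).
Local Notation S := (seq_space X).
Local Notation F := (iid_filtration X).
Variables (P0 P1 : probability X R) (PP0 PP1 : probability S R).
Hypotheses (iid0 : is_iid_product P0 PP0) (iid1 : is_iid_product P1 PP1).
Hypothesis P10 : P1 `<< P0.

Local Notation rho := (rdensity P0 P1).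

(** For [f >= 0] this is independence from an indicator; a finite integral of [f^+] then lets the
    two parts recombine. It is meant for [f = log rho], whose integral may be [-oo]. *)
Lemma integral_coord_on_stage n A (f : X -> \bar R) : F n A ->
    measurable_fun setT f -> \int[P0]_x f^\+ x < +oo ->
  \int[PP0]_(w in A) f (w n) = \int[P0]_x f x * PP0 A.
Proof.
move=> FA mf fy; have mA := stage_measurable FA.
have ge0 (h : X -> \bar R) : measurable_fun setT h -> (forall x, 0 <= h x) ->
    \int[PP0]_(w in A) h (w n) = \int[P0]_x h x * PP0 A.
  move=> mh h0.
  have -> : PP0 A = \int[PP0]_w (\1_A w)%:E by rewrite integral_indic// setIT.
  rewrite -(integral_independent_coord iid0 (n := n))//.
    rewrite integral_mkcond; apply: eq_integral => w _; rewrite /patch indicE.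
    by case: ifP; rewrite ?mule1 ?mule0.
  by apply/measurable_EFinP; apply: measurable_indic; rewrite stage_measurableE.
have mfp : measurable_fun setT f^\+ by exact: measurable_funepos.
have mfn : measurable_fun setT f^\- by exact: measurable_funeneg.
rewrite [LHS]integralE.
rewrite (_ : (fun w => f (w n))^\+ = fun w => f^\+ (w n)); last first.
  by apply/funext => w; rewrite !funeposE.
rewrite (_ : (fun w => f (w n))^\- = fun w => f^\- (w n)); last first.
  by apply/funext => w; rewrite !funenegE.
rewrite !ge0// [X in _ = X * _]integralE [RHS]muleBl//.
  exact: fin_num_measure.
apply: fin_num_adde_defr; rewrite ge0_fin_numE//; exact: integral_ge0.
Qed.

Definition likelihood_prod n (w : S) : R := \prod_(i < n) rho (w i).

Lemma likelihood_prodS n w :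
  likelihood_prod n.+1 w = (likelihood_prod n w * rho (w n))%R.
Proof. by rewrite /likelihood_prod big_ord_recr. Qed.

Lemma likelihood_prod_ge0 n w : (0 <= likelihood_prod n w)%R.
Proof. by apply: prodr_ge0 => i _; exact: rdensity_ge0. Qed.

Lemma measurable_likelihood_prod n :
  measurable_fun setT (likelihood_prod n : g_sigma_algebraType (F n) -> R).
Proof.
elim: n => [|n IH].
  rewrite (_ : likelihood_prod 0 = cst 1%R); first exact: measurable_cst.
  by apply/funext => w; rewrite /likelihood_prod big_ord0.
rewrite (_ : likelihood_prod n.+1 =
    fun w => (likelihood_prod n w * rho (w n))%R); last first.
  by apply/funext => w; rewrite likelihood_prodS.
apply: measurable_funM; first exact: (stage_measurable_mono (leqnSn n) IH).
apply: (measurableT_comp (measurable_rdensity P10)).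
exact: (@measurable_coord_stage _ X n.+1 n).
Qed.

(** Both sides are measures on [F n], so rectangles suffice; there independence splits off one
    coordinate at a time. *)
Lemma likelihood_prod_integral n A : F n A ->
  PP1 A = \int[PP0]_(w in A) (likelihood_prod n w)%:E.
Proof.
have mL k : measurable_wrt (F k) (fun w => (likelihood_prod k w)%:E).
  by apply/measurable_EFinP; exact: measurable_likelihood_prod.
have L0 k w : 0 <= (likelihood_prod k w)%:E by rewrite lee_fin likelihood_prod_ge0.
have rect k (B : nat -> set X) : (forall i, measurable (B i)) ->
    \int[PP0]_w ((\1_(rectangle k B) w)%:E * (likelihood_prod k w)%:E) =
    \prod_(i < k) P1 (B i).
  move=> mB; elim: k => [|k IH].
    rewrite big_ord0 (eq_integral (cst 1)); last first.
      move=> w _; rewrite /likelihood_prod big_ord0 mule1 indicE mem_set//.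
    by rewrite integral_cst// mul1e [LHS]probability_setT.
  rewrite big_ord_recr/= -IH muleC (rdensity_integral P10 (mB k)).
  rewrite [X in _ = X * _](_ : _ = \int[P0]_x ((\1_(B k) x)%:E * (rho x)%:E)); last first.
    rewrite integral_mkcond; apply: eq_integral => x _; rewrite /patch indicE.
    by case: ifP; rewrite ?mul1e ?mul0e.
  have mr : measurable_fun setT (fun x => (rho x)%:E).
    by apply/measurable_EFinP; exact: measurable_rdensity.
  have mi : measurable_fun setT (fun x => (\1_(B k) x)%:E : \bar R).
    by apply/measurable_EFinP; exact: measurable_indic.
  rewrite -(integral_independent_coord iid0 (n := k)).
  - apply: eq_integral => w _; rewrite rectangleS likelihood_prodS !indicE in_setI.
    rewrite -mulnb natrM !EFinM; set a := (_ \in _)%:R%:E.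
    rewrite (_ : (w \in [set w | B k (w k)]) = (w k \in B k)); last first.
      by apply/idP/idP; rewrite !inE.
    by rewrite muleACA muleC.
  - apply: emeasurable_funM; last exact: mL.
    apply/measurable_EFinP; apply: measurable_indic.
    by rewrite stage_measurableE; exact: stage_rectangle.
  - by move=> w; rewrite mule_ge0// lee_fin.
  - exact: emeasurable_funM.
  - by move=> x; rewrite mule_ge0// lee_fin ?rdensity_ge0.
move=> FA; have [m mE] := exists_density_measure PP0
  (measurable_wrt_measurable (mL n)) (L0 n).
rewrite -mE; apply: (@measure_eq_on_stage _ X R n PP1 m) => //.
  by rewrite [ltLHS]probability_setT ltry.
move=> B mB; rewrite mE; transitivity (\prod_(i < n) P1 (B i)).
  exact: (rectangle_product iid1).
rewrite -rect// [RHS]integral_mkcond; apply: eq_integral => w _; rewrite /patch indicE.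
by case: ifP; rewrite ?mul1e ?mul0e.
Qed.

Lemma iid_ac t : restr F t PP1 `<< restr F t PP0.
Proof.
apply/null_content_dominatesP => A; rewrite stage_measurableE => FA A0.
have mA := stage_measurable FA.
rewrite [LHS](likelihood_prod_integral FA); apply: null_set_integral => //.
apply: measurable_funTS; apply: (@measurable_wrt_measurable _ _ _ F t).
by apply/measurable_EFinP; exact: measurable_likelihood_prod.
Qed.

Local Notation rlik := (rlik F PP0 PP1).

Lemma rlik_likelihood_prod n : exists N, [/\ F n N, PP0 N = 0 &
  forall w, ~ N w -> rlik n w = likelihood_prod n w].
Proof.
have mL : measurable_wrt (F n) (fun w => (likelihood_prod n w)%:E).
  by apply/measurable_EFinP; exact: measurable_likelihood_prod.
have mlk : measurable_wrt (F n) (fun w => (rlik n w)%:E).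
  by apply/measurable_EFinP; exact: (measurable_rlik iid_ac).
have E A : F n A -> \int[PP0]_(w in A) (rlik n w)%:E =
    \int[PP0]_(w in A) (likelihood_prod n w)%:E.
  by move=> FA; rewrite -(lik_integral iid_ac FA) -likelihood_prod_integral.
have [A FA _|N [FN N0 NE]] :=
    @stage_ae_le_integral _ _ _ _ PP0 _ _ _ _ (stage_setT F n) mL mlk.
  by rewrite E.
have [A FA _|M [FM M0 ME]] :=
    @stage_ae_le_integral _ _ _ _ PP0 _ _ _ _ (stage_setT F n) mlk mL.
  by rewrite E.
exists (N `|` M); split.
- by rewrite -stage_measurableE; apply: measurableU; rewrite stage_measurableE.
- by apply: null_set_setU => //; [exact: stage_measurable FN|exact: stage_measurable FM].
move=> w /not_orP[Nw Mw]; apply/eqP; rewrite eq_le -!lee_fin.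
by rewrite NE// ME.
Qed.

Definition mean_lne_density := \int[P0]_x lne (rho x)%:E.

Lemma funepos_lne_rho_lty : \int[P0]_x (fun y => lne (rho y)%:E)^\+ x < +oo.
Proof.
apply: le_lt_trans (integrable_lty measurableT (rdensity_integrable P10)).
have mr := measurable_rdensity P10.
apply: ge0_le_integral => //.
- by apply: measurable_funepos; exact: measurable_lne_comp.
- by apply/measurable_EFinP.
- move=> x _; rewrite funeposE ge_max lee_fin rdensity_ge0 andbT.
  by apply/ltW/lne_sublinear.
Qed.

Lemma mean_lne_density_lty : mean_lne_density < +oo.
Proof.
rewrite /mean_lne_density integralE; apply: le_lt_trans funepos_lne_rho_lty.
by rewrite -[leRHS]sube0 leeB// integral_ge0.
Qed.

(** Where [L_n > 0], the ratio is [rho (w n)], independent of [F n]. Where [L_n = 0], the ratio is 1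
    by convention and the rate vanishes instead; that set is null for [PP1] but possibly not for
    [PP0], hence the choice of [PP1]. *)
Lemma lam0_iid n : {ae PP1, forall w, lam0 F PP0 PP1 n.+1 w = - mean_lne_density}.
Proof.
have [mg gE] := log_lik_ratio_condexp iid_ac n.
have [N [FN N0 NE]] := lam0E iid_ac n.
have [M [FM M0 ME]] := rlik_likelihood_prod n.
have [M' [FM' M'0 M'E]] := rlik_likelihood_prod n.+1.
set g := condexp _ _ _ in mg gE NE.
pose D := [set w | (0 < rlik n w)%R].
have FD : F n D by exact: (stage_rlik_gt0 iid_ac).
have mlr : measurable_fun setT (fun x => lne (rho x)%:E).
  by apply: measurable_lne_comp; exact: measurable_rdensity.
have gD A : F n A -> A `<=` D -> \int[PP0]_(w in A) g w =
    \int[PP0]_(w in A) cst mean_lne_density w.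
  move=> FA AD; have mA := stage_measurable FA.
  rewrite gE// integral_cst// -(integral_coord_on_stage FA mlr funepos_lne_rho_lty).
  apply: ae_eq_integral => //.
  - by apply: measurable_funTS; apply: measurable_lne_comp; exact: (measurable_rratioT iid_ac).
  - apply: measurable_funTS; apply: (measurableT_comp mlr); exact: measurable_coord.
  exists (M `|` M'); split.
  - by apply: measurableU; [exact: stage_measurable FM|exact: stage_measurable FM'].
  - by apply: null_set_setU => //; [exact: stage_measurable FM|exact: stage_measurable FM'].
  move=> w /= h; apply: contrapT => /not_orP[Mw M'w]; apply: h => Aw.
  have := AD _ Aw; rewrite /D/= => lw.
  rewrite /rratio lw M'E// likelihood_prodS -ME// mulrAC divff ?mul1r// gt_eqF//.
have [A FA AD|K [FK K0 KE]] := @stage_ae_le_integral _ _ _ _ PP0 _ _ _ _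
    FD mg (measurable_cst mean_lne_density).
  by rewrite gD.
have [A FA AD|K' [FK' K'0 K'E]] := @stage_ae_le_integral _ _ _ _ PP0 _ _ _ _
    FD (measurable_cst mean_lne_density) mg.
  by rewrite gD.
have FDC : F n (~` D).
  by rewrite -stage_measurableE; apply: measurableC; rewrite stage_measurableE.
have null1 B : F n B -> PP0 B = 0 -> PP1.-negligible B.
  move=> FB B0; apply/negligibleP; first exact: stage_measurable FB.
  exact: (null_transfer iid_ac FB B0).
have D1 : PP1.-negligible (~` D).
  apply/negligibleP; first exact: stage_measurable FDC.
  rewrite [LHS](lik_integral iid_ac FDC) (eq_integral (cst 0)) ?integral0//.
  move=> w; rewrite inE /D/= => /negP; rewrite -leNgt => lw.
  by congr (_%:E); apply/eqP; rewrite eq_le lw rlik_ge0.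
apply: (@negligibleS _ _ _ _ (~` D `|` (N `|` (K `|` K')))); last first.
  by apply: negligibleU => //; apply: negligibleU; [exact: null1|apply: negligibleU; exact: null1].
move=> w /= h; apply: contrapT => /not_orP[/contrapT Dw /not_orP[Nw /not_orP[Kw K'w]]].
by apply: h; rewrite NE//; congr (- _); apply/eqP; rewrite eq_le KE// K'E.
Qed.

Lemma lam0_mean_iid t : (0 < t)%N -> lam0_mean F PP0 PP1 t = - mean_lne_density.
Proof.
move=> t0; rewrite lam0_meanE.
rewrite (eq_bigr (fun=> - mean_lne_density)); last first.
  move=> i _; apply: ess_sup_ae_cst; last exact: lam0_iid.
  by rewrite [X in _ < X]probability_setT lte01.
have tV0 : (0 < t%:R^-1 :> R)%R by rewrite invr_gt0 ltr0n.
have : -oo < - mean_lne_density by rewrite lteNr; exact: mean_lne_density_lty.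
case: (- mean_lne_density) => [k| |]// _.
  rewrite sumEFin sumr_const card_ord -EFinM -[(k *+ t)%R]mulr_natr mulrCA mulVf ?mulr1//.
  by rewrite pnatr_eq0 -lt0n.
(* In the infinite case the first summand is [+oo] and the others are nonnegative. *)
case: t t0 tV0 => // t _ tV0.
by rewrite big_ord_recl addye ?gt0_muley// -ltNye (lt_le_trans ltNy0)// sume_ge0.
Qed.

End iid_rates.

(** * Single-letter rates and relative entropy *)

Section single_letter.
Context d (X : measurableType d) (R : realType).
Variables (P0 P1 : probability X R).
Hypothesis P10 : P1 `<< P0.

Local Notation rho := (rdensity P0 P1).
Local Notation mean_lne_density := (mean_lne_density P0 P1).

Let mrho : measurable_fun setT rho. Proof. exact: measurable_rdensity. Qed.

Let rho0 x : (0 <= rho x)%R. Proof. exact: rdensity_ge0. Qed.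

Let irho : P0.-integrable setT (fun x => (rho x)%:E).
Proof. exact: rdensity_integrable. Qed.

Let mlne : measurable_fun setT (fun x => lne (rho x)%:E).
Proof. exact: measurable_lne_comp. Qed.

Let P0T : P0 setT = 1. Proof. exact: probability_setT. Qed.

Let P0Tfin : P0 setT \is a fin_num. Proof. by rewrite P0T. Qed.

(** Changing measure twice shows that the two densities have product 1 almost surely for [P0], so
    their logarithms are opposite. *)
Lemma KL_mean_lne_density_dominated : P0 `<< P1 ->
  KL P0 P1 = - mean_lne_density.
Proof.
move=> P01; rewrite /KL asboolT//.
have msigma := measurable_rdensity P01.
have msE : measurable_fun setT (fun x => (rdensity P1 P0 x)%:E) by exact/measurable_EFinP.
have mrE : measurable_fun setT (fun x => (rho x)%:E) by exact/measurable_EFinP.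
have prod1 : ae_eq P0 setT (cst 1) (fun x => (rdensity P1 P0 x)%:E * (rho x)%:E).
  apply: integral_ae_eq => //.
  - exact: finite_measure_integrable_cst.
  - exact: emeasurable_funM.
  move=> A _ mA; rewrite integral_cst// mul1e.
  transitivity (\int[P1]_(x in A) (rdensity P1 P0 x)%:E).
    exact: (rdensity_integral P01).
  rewrite [LHS]integral_mkcond [RHS]integral_mkcond.
  rewrite (rdensity_change_of_measure P10).
  - apply: eq_integral => x _; rewrite /patch; case: ifP => // _.
    by rewrite mul0e.
  - by apply/(measurable_restrictT _ mA); exact: measurable_funTS.
  - by move=> x; rewrite /patch; case: ifP => // _; rewrite lee_fin rdensity_ge0.
have densE : {ae P0, forall x, density P0 P1 x = (rdensity P1 P0 x)%:E}.
  have [N [mN N0 NE]] := density_ae_eq P01; exists N; split => //.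
  by have /null_content_dominatesP := P01; apply.
(* The sign passes through the integral because the positive part of [log rho] has a finite
   integral. *)
rewrite /mean_lne_density -integralN; last first.
  apply: fin_num_adde_defr; rewrite ge0_fin_numE; last exact: integral_ge0.
  exact: funepos_lne_rho_lty.
apply: ae_eq_integral => //.
- by apply: (measurableT_comp (@emeasurable_lne R)); exact: measurable_density.
- exact: measurableT_comp.
apply: filterS2 densE prod1 => x dx /(_ I) /esym sr _; rewrite dx.
move: sr; rewrite -EFinM => -[sr].
have rn0 : rho x != 0%R.
  by apply/eqP => r0; move: sr; rewrite r0 mulr0 => /esym/eqP; rewrite oner_eq0.
have r1 : (0 < rho x)%R by rewrite lt_neqAle eq_sym rn0 rho0.
have -> : rdensity P1 P0 x = (rho x)^-1%R.
  by rewrite -[LHS]mulr1 -(divff rn0) mulrA sr mul1r.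
by rewrite lneV.
Qed.

(** On a set that is null for [P1] but not for [P0], [rho = 0] almost surely, so the negative part
    of [log rho] has infinite integral. *)
Lemma mean_lne_density_not_dominated : ~ P0 `<< P1 -> mean_lne_density = -oo.
Proof.
move=> P01; have [A [mA A1 A0]] : exists A, [/\ measurable A, P1 A = 0 & P0 A != 0].
  apply: contrapT => h; apply: P01; apply/null_content_dominatesP => A mA A1.
  by apply/eqP; apply: contrapT => /negP A0; apply: h; exists A.
have rA : ae_eq P0 A (fun x => (rho x)%:E) (cst 0).
  apply/ae_eq_integral_abs => //; first by apply: measurable_funTS; exact/measurable_EFinP.
  rewrite -A1 (rdensity_integral P10 mA); apply: eq_integral => x _.
  by rewrite gee0_abs// lee_fin.
have negA : \int[P0]_(x in A) (fun x => lne (rho x)%:E)^\- x = +oo.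
  rewrite (ae_eq_integral (cst +oo))//.
  - by rewrite integral_cst// gt0_mulye// lt_neqAle eq_sym A0 measure_ge0.
  - by apply: measurable_funTS; exact: measurable_funeneg.
  by apply: filterS rA => x + Ax => /(_ Ax) r0; rewrite funenegE r0 le0_lneNy.
rewrite /mean_lne_density integralE.
have -> : \int[P0]_x (fun x => lne (rho x)%:E)^\- x = +oo.
  apply/eqP; rewrite -leye_eq -negA; apply: ge0_subset_integral => //.
  exact: measurable_funeneg.
by rewrite addeNy.
Qed.

Lemma KL_mean_lne_density : KL P0 P1 = - mean_lne_density.
Proof.
have [P01|P01] := pselect (P0 `<< P1); first exact: KL_mean_lne_density_dominated.
by rewrite /KL asboolF// mean_lne_density_not_dominated.
Qed.

Lemma lam_iidE b : lam_iid P0 P1 b =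
  - ((b^-1)%:E * lne (\int[P0]_x (rho x `^ b)%:E)).
Proof.
rewrite /lam_iid; congr (- (_ * lne _)); apply: ae_eq_integral => //.
- apply: (measurableT_comp (@measurable_poweR R b)); exact: measurable_density.
- by apply/measurable_EFinP; exact: measurable_powR_comp.
by apply: filterS (density_ae_eq P10) => x -> _.
Qed.

(** Jensen's inequality on the whole space; in the argument by contradiction, the rational [q]
    supplies a real level separating the two sides. *)
Lemma lam_iid_le b : (0 < b)%R -> lam_iid P0 P1 b <= - mean_lne_density.
Proof.
move=> b0; rewrite lam_iidE leeN2 leNgt; apply/negP => /lte_rat_between[q /andP[Zq qk]].
have Zb : \int[P0]_x (rho x `^ b)%:E <= (expR (b * ratr q))%:E * P0 setT.
  rewrite P0T mule1 -lee_lne_expR EFinM -lee_pdivrMl//.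
  exact: ltW.
have : mean_lne_density <= (b * ratr q / b)%:E * P0 setT.
  exact: (integral_lne_le mrho rho0 measurableT P0Tfin b0 Zb).
by rewrite P0T mule1 mulrAC divff ?gt_eqF// mul1r leNgt qk.
Qed.

(** For small [b], the mean of [rho^b] is below [1 - b M <= exp (- b M)]. *)
Lemma lam_iid_near M : M%:E < - mean_lne_density ->
  \forall b \near 0^'+, M%:E <= lam_iid P0 P1 b.
Proof.
move=> Mk; have kM : mean_lne_density < (- M)%:E by rewrite EFinN lteNr.
have [e /andP[e0 e1] eZ] := integral_powR_lt mrho rho0 measurableT P0Tfin irho kM.
near=> b.
have b0 : (0 < b)%R by near: b; exact: nbhs_right_gt.
have be : (b <= e)%R by near: b; exact: nbhs_right_le.
have Zb : \int[P0]_x (rho x `^ b)%:E <= (expR (b * - M))%:E.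
  apply: (@le_trans _ _ (1 + (b * - M)%:E)).
    by apply: ltW; rewrite -P0T; apply: eZ; rewrite b0.
  by rewrite lee_fin expR_ge1Dx.
rewrite lam_iidE leeNr -EFinN lee_pdivrMl// -EFinM.
by rewrite lee_lne_expR.
Unshelve. all: by end_near. Qed.

Lemma lam_iid_cvg : lam_iid P0 P1 b @[b --> 0^'+] --> - mean_lne_density.
Proof.
have : -oo < - mean_lne_density by rewrite lteNr; exact: mean_lne_density_lty.
have near_le : \forall b \near 0^'+, lam_iid P0 P1 b <= - mean_lne_density.
  by near=> b; apply: lam_iid_le; near: b; exact: nbhs_right_gt.
(* The limit is real or [+oo]. In the real case the lower bound is used at [k - 1] for finiteness
   and at [k - e] for closeness. *)
move: near_le lam_iid_near; case: (- mean_lne_density) => [k| |]// near_le near_ge _.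
  apply/fine_cvgP; split.
    have := near_ge (k - 1)%R; rewrite lte_fin gtrBl ltr01 => /(_ isT).
    apply: filterS2 near_le => b bk kb.
    by rewrite fin_numElt (lt_le_trans _ kb) ?ltNyr// (le_lt_trans bk)// ltry.
  apply/cvgrPdist_le => e e0.
  have := near_ge (k - e)%R; rewrite lte_fin gtrBl e0 => /(_ isT).
  apply: filterS2 near_le => b bk kb.
  have : lam_iid P0 P1 b \is a fin_num.
    by rewrite fin_numElt (lt_le_trans _ kb) ?ltNyr// (le_lt_trans bk)// ltry.
  move=> /fineK lE; move: bk kb; rewrite -lE !lee_fin /= => lek kel.
  by rewrite ger0_norm ?subr_ge0//; lra.
by apply/cvgeyPge => M; apply: near_ge; rewrite ltry.
Unshelve. all: by end_near. Qed.

(** A single wealth step over the whole space, with [l = - E_P0[log R]]; if this is [+oo] the bound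
    is trivial. *)
Lemma growth_iid_le (E : X -> \bar R) : measurable_fun setT E ->
    (forall x, 0 <= E x) -> \int[P0]_x E x <= 1 ->
  growth_iid P1 E <= - mean_lne_density.
Proof.
move=> mE E0 E1; apply: ge_ereal_sup => _ [s /= s0 <-].
have : -oo < - mean_lne_density by rewrite lteNr; exact: mean_lne_density_lty.
case kE : (- mean_lne_density) => [k| |]// _; last exact: leey.
rewrite leeNl -EFinN lee_expR_lne.
rewrite (rdensity_change_of_measure P10); last 2 first.
- exact: measurable_poweR_inv.
- by move=> x; exact: poweR_inv_ge0.
have EP : \int[P0]_x E x <= P0 setT by rewrite P0T.
have kP : - (k%:E * P0 setT) <= \int[P0]_x lne (rho x)%:E.
  by rewrite P0T mule1 -kE oppeK.
have : (expR (- k))%:E * P0 setT <= \int[P0]_x ((E x `^ s)^-1 * (rho x)%:E).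
  exact: (integral_wealth_ge mrho rho0 measurableT P0Tfin irho s0 mE E0 EP kP).
by rewrite P0T mule1.
Qed.

End single_letter.

(** The assumption starts at [t = 1]; at stage 0 the only sets are the empty and the full one, and
    the latter is not null. *)
Lemma standing_assumption_ac d (T : measurableType d) (R : realType)
    (F : filtration T) (P0 P1 : probability T R) :
    standing_assumption F P0 P1 ->
  forall t, restr F t P1 `<< restr F t P0.
Proof.
move=> sa [|t]; last by have [] := sa t.+1 isT.
apply/null_content_dominatesP => A; rewrite stage_measurableE => FA PA0.
have : [set set0; setT] A by rewrite -(sigma_at0 F).
move=> [A0|AT]; first by rewrite A0 measure0.
rewrite AT in PA0.
have : P0 setT = 0 by exact: PA0.
by rewrite probability_setT => /eqP; rewrite onee_eq0.
Qed.

Theorem corollary4p13 (R : realType) :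
  (forall (d : measure_display) (T : measurableType d) (F : filtration T)
      (P0 P1 : probability T R),
    standing_assumption F P0 P1 ->
    (forall E : nat -> T -> \bar R, betting F P0 E ->
      forall t : nat, (0 < t)%N ->
        (forall s : R, (0 <= s)%R -> growth P1 E s t <= lam0_mean F P0 P1 t) /\
        growth_sup P1 E t <= lam0_mean F P0 P1 t) /\
    (forall n : nat, (0 < n)%N ->
      let identity w := lam0 F P0 P1 n w =
        - condexp P0 (F n.-1) (fun w' => lne (lik_ratio F P0 P1 n w')) w in
      {ae P0, forall w, identity w} /\ {ae P1, forall w, identity w})) /\
  (forall (d : measure_display) (X : measurableType d) (P0 P1 : probability X R),
    P1 `<< P0 -> KL P1 P0 < +oo ->
    lam_iid P0 P1 b @[b --> 0^'+] --> KL P0 P1 /\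
    (forall PP0 PP1 : probability (seq_space X) R,
      is_iid_product P0 PP0 -> is_iid_product P1 PP1 ->
      (forall t : nat, (0 < t)%N ->
        lam0_mean (iid_filtration X) PP0 PP1 t = KL P0 P1) /\
      (forall E : nat -> seq_space X -> \bar R,
        betting (iid_filtration X) PP0 E ->
        forall (s : R) (t : nat), (0 <= s)%R -> (0 < t)%N ->
          growth PP1 E s t <= KL P0 P1)) /\
    (forall E : X -> \bar R, measurable_fun [set: X] E -> (forall x, 0 <= E x) ->
      \int[P0]_x E x <= 1 -> growth_iid P1 E <= KL P0 P1)).
Proof.
split=> [d T F P0 P1 sa|d X P0 P1 P10 _].
  have ac := standing_assumption_ac sa; split=> [E bE t t0|[//|n] _ identity].
    split=> [s s0|]; first exact: growth_le_mean.
    by apply: ge_ereal_sup => _ [s s0 <-]; exact: growth_le_mean.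
  by have [N [FN N0 NE]] := lam0E ac n; exact: (ae_transfer ac FN N0 NE).
rewrite (KL_mean_lne_density P10); split; [exact: lam_iid_cvg|split]; last first.
  by move=> E; exact: growth_iid_le.
move=> PP0 PP1 iid0 iid1; split=> [t|E bE s t s0 t0].
  exact: (lam0_mean_iid iid0 iid1 P10).
rewrite -(lam0_mean_iid iid0 iid1 P10 t0).
exact: (growth_le_mean (iid_ac iid0 iid1 P10)).
Qed.
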